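(* Let $p$ be a prime, $d,m_1,\ldots,m_d$ positive integers, $\boldsymbol{\alpha}\in\mathbb{Q}^d$ with $\alpha_1=0$ and $\alpha_i-\alpha_j\notin\mathbb{Z}$ for $i\ne j$, $M=\sum_im_i+d-1$, $\mathcal{I}=\{(i,s):1\le i\le d,1\le s\le m_i+1\}\setminus\{(1,1)\}$. Let $x\in\mathbb{Q}$ with $|x|_p\ge q_p\max_{1\le i\le d}\{1,|\alpha_i|_p\}$. Let $\beta,\rho_\infty,\rho_p,\delta$ be real numbers and $(D_n)_{n\ge0}$ a sequence of positive integers such that, for every $n\ge0$, every $(i,s)\in\mathcal{I}$ and every $\ell=0,\ldots,M$, the numbers $D_nP_{n,\ell}(x)$ and $D_nQ_{n,i,s,\ell}(x)$ are integers, and \[ \limsup_{n\to\infty}\max\{|P_{n,\ell}(x)|,|Q_{n,i,s,\ell}(x)|\}^{1/n}\le e^\beta,\quad \limsup_{n\to\infty}D_n^{1/n}\le e^{\rho_\infty}, \] \[ \limsup_{n\to\infty}|D_n|_p^{1/n}\le e^{-\rho_p},\quad \limsup_{n\to\infty}|\mathfrak{R}_{n,i,s,\ell}(x)|_p^{1/n}\le e^{-\delta}. \] Suppose $\beta+\rho_\infty<\delta+\rho_p$. Then the $M+1$ elements $1,\ (R_{\alpha_i,s}(x))_{(i,s)\in\mathcal{I}}$ of $\mathbb{Q}_p$ are linearly independent over $\mathbb{Q}$.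
   Context: $|\cdot|_p$ is the $p$-adic absolute value, $q_p=p$ if $p\ge3$, $q_p=4$ if $p=2$. $(x)_n=x(x+1)\cdots(x+n-1)$; $\binom\alpha k=\alpha(\alpha-1)\cdots(\alpha-k+1)/k!$; Bernoulli polynomials $B_k(y)$: $ze^{yz}/(e^z-1)=\sum_kB_k(y)z^k/k!$, $B_k=B_k(0)$. $\Delta_{-1}P(z)=P(z-1)-P(z)$. For $f=\sum_{k\ge0}f_kz^{-k-1}\in(1/z)\mathbb{Q}[[1/z]]$, $\varphi_f:\mathbb{Q}[t]\to\mathbb{Q}$ is linear with $t^k\mapsto f_k$, extended $\mathbb{Q}[z]$-linearly. Modified inverse Mellin transform: for $g\in\mathbb{Q}[[z]]$, $g(e^z-1)=\sum_kb_kz^k/k!$, $\mathcal{M}^{-1}(g)=\sum_kb_k(-1/z)^{k+1}$. Formal series $R_{\alpha,s}(z)=\mathcal{M}^{-1}((1+z)^\alpha\log^{s-1}(1+z)/z)$ for $s\ge2$, $R_{\alpha,1}(z)=\mathcal{M}^{-1}(((1+z)^\alpha-1)/z)$; $\varphi_{\alpha,s}=\varphi_{R_{\alpha,s}}$. $A_{n,\ell}(z)=(-1)^\ell\frac{(z)_\ell}{\ell!}\prod_{i=1}^d\big((-1)^n\frac{(z+\alpha_i)_n}{n!}\big)^{m_i+1}$, $P_{n,\ell}(z)=\Delta_{-1}^n(A_{n,\ell}(z))$, $Q_{n,i,s,\ell}(z)=\varphi_{\alpha_i,s}\big(\frac{P_{n,\ell}(z)-P_{n,\ell}(t)}{z-t}\big)$.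 $p$-adic values: for $s\ge2$, $R_{\alpha_i,s}(x)=\sum_{k\ge s-2}(k-s+3)_{s-2}B_{k-s+2}\frac{(-1)^{k+1}}{(x+\alpha_i)^{k+1}}$; for $s=1$, $R_{\alpha_i,1}(x)=\sum_{k\ge0}\frac{B_{k+1}(\alpha_i)-B_{k+1}}{k+1}\frac{(-1)^{k+1}}{x^{k+1}}$ (convergent in $\mathbb{Q}_p$); and $\mathfrak{R}_{n,i,s,\ell}(x)=P_{n,\ell}(x)R_{\alpha_i,s}(x)-Q_{n,i,s,\ell}(x)$. *)

(* Defs.v *)
From HB Require Import structures.
From mathcomp Require Import all_boot all_order all_algebra.
From mathcomp Require Import all_classical all_reals all_analysis.
From mathcomp Require Import ring.

Set Implicit Arguments.
Unset Strict Implicit.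
Unset Printing Implicit Defensive.
Import Order.TTheory GRing.Theory Num.Theory.
Local Open Scope classical_set_scope.
Local Open Scope ring_scope.

Section PadicAbs.
Variable p : nat.
Implicit Types (a b : int) (x y : rat).

Definition padic_val x : int :=
  (logn p `|numq x|%N)%:Z - (logn p `|denq x|%N)%:Z.

(* [logn p] vanishes identically when [p] is not prime, so that [padic_abs p]
   is then the trivial absolute value: the construction of [Qp p] below needs
   no primality assumption. *)
Definition padic_abs x : rat :=
  if x == 0 then 0 else p%:R ^ (- padic_val x).

Let base : rat := if prime p then p%:R else 2%:R.

Let base_gt1 : 1 < base.
Proof.
by rewrite /base; case: ifPn => // pp; rewrite (ltr_nat _ 1) prime_gt1.
Qed.

Let base_gt0 : 0 < base. Proof. exact: lt_trans base_gt1. Qed.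

Lemma padic_val_frac a b : a != 0 -> b != 0 ->
  padic_val (a%:~R / b%:~R) = (logn p `|a|%N)%:Z - (logn p `|b|%N)%:Z.
Proof.
move=> a0 b0; rewrite /padic_val; set x := a%:~R / b%:~R.
have x0 : x != 0 by rewrite mulf_neq0 ?invr_eq0 ?intr_eq0.
have : (`|numq x| * `|b|)%N = (`|a| * `|denq x|)%N.
  rewrite -!abszM; congr absz; apply: (@intr_inj rat).
  rewrite !rmorphM /= numqE /x mulrAC mulfVK ?intr_eq0//.
move/(congr1 (logn p)); rewrite !lognM ?absz_gt0 ?numq_eq0 ?denq_eq0//.
by move=> h; apply/eqP; rewrite subr_eq addrAC eq_sym subr_eq -!PoszD h.
Qed.

Let absE x : x != 0 -> padic_abs x = base ^ (- padic_val x).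
Proof.
move=> x0; rewrite /padic_abs (negPf x0) /base; case: ifPn => // pp.
have l0 m : logn p m = 0%N by rewrite lognE (negPf pp).
by rewrite /padic_val !l0 subrr oppr0 !expr0z.
Qed.

Lemma padic_abs0 : padic_abs 0 = 0. Proof. by rewrite /padic_abs eqxx. Qed.

Lemma padic_abs_gt0 x : x != 0 -> 0 < padic_abs x.
Proof. by move=> x0; rewrite absE// exprz_gt0. Qed.

Lemma padic_abs_ge0 x : 0 <= padic_abs x.
Proof.
by have [->|/padic_abs_gt0/ltW//] := eqVneq x 0; rewrite padic_abs0.
Qed.

Lemma padic_abs_eq0 x : (padic_abs x == 0) = (x == 0).
Proof.
apply/eqP/eqP => [|->]; last exact: padic_abs0.
by have [//|/padic_abs_gt0/gt_eqF h /eqP] := eqVneq x 0; rewrite h.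
Qed.

Lemma padic_absM x y : padic_abs (x * y) = padic_abs x * padic_abs y.
Proof.
have [->|x0] := eqVneq x 0; first by rewrite mul0r padic_abs0 mul0r.
have [->|y0] := eqVneq y 0; first by rewrite mulr0 padic_abs0 mulr0.
rewrite !absE ?mulf_neq0// -expfzDr ?gt_eqF// -opprD; congr (_ ^ - _).
rewrite -{1}(divq_num_den x) -{1}(divq_num_den y) mulf_div -!rmorphM.
rewrite padic_val_frac ?mulf_neq0 ?numq_eq0 ?denq_eq0// !abszM.
rewrite !lognM ?absz_gt0 ?numq_eq0 ?denq_eq0//.
by rewrite /padic_val !PoszD opprD addrACA.
Qed.

Lemma padic_abs1 : padic_abs 1 = 1.
Proof.
have h := padic_absM 1 1; rewrite mulr1 in h.
by apply: (mulfI (_ : padic_abs 1 != 0)); rewrite ?mulr1 -?h// padic_abs_eq0.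
Qed.

Lemma padic_absV x : padic_abs x^-1 = (padic_abs x)^-1.
Proof.
have [->|x0] := eqVneq x 0; first by rewrite !(invr0, padic_abs0).
apply: (mulfI (_ : padic_abs x != 0)); first by rewrite padic_abs_eq0.
by rewrite -padic_absM !divff ?padic_abs1// padic_abs_eq0.
Qed.

Lemma padic_absN x : padic_abs (- x) = padic_abs x.
Proof.
have h : padic_abs (-1) = 1.
  apply/eqP; rewrite -(@eqrXn2 _ 2)// ?padic_abs_ge0// expr1n expr2.
  by rewrite -padic_absM mulrNN mulr1 padic_abs1.
by rewrite -mulN1r padic_absM h mul1r.
Qed.

Lemma padic_absD x y :
  padic_abs (x + y) <= Num.max (padic_abs x) (padic_abs y).
Proof.
have [->|x0] := eqVneq x 0.
  by rewrite add0r le_max lexx orbT.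
have [->|y0] := eqVneq y 0; first by rewrite addr0 le_max lexx.
have [->|xy0] := eqVneq (x + y) 0.
  by rewrite padic_abs0 le_max padic_abs_ge0.
pose a := numq x * denq y; pose b := numq y * denq x.
pose c := denq x * denq y.
have c0 : c != 0 by rewrite mulf_neq0 ?denq_eq0.
have a0 : a != 0 by rewrite mulf_neq0 ?numq_eq0 ?denq_eq0.
have b0 : b != 0 by rewrite mulf_neq0 ?numq_eq0 ?denq_eq0.
have ex : x = a%:~R / c%:~R.
  by rewrite /a /c !rmorphM /= -mulf_div divff ?intr_eq0 ?denq_eq0// mulr1
             divq_num_den.
have ey : y = b%:~R / c%:~R.
  rewrite /b /c [denq x * _]mulrC !rmorphM /= -mulf_div.
  by rewrite divff ?intr_eq0 ?denq_eq0// mulr1 divq_num_den.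
have exy : x + y = (a + b)%:~R / c%:~R by rewrite ex ey -mulrDl rmorphD.
have ab0 : a + b != 0.
  by apply: contraNneq xy0 => h; rewrite exy h mul0r.
rewrite le_max !absE// !ler_eXz2l// !lerN2 exy {1}ex ey !padic_val_frac//.
rewrite !lerD2r !lez_nat -geq_min.
have [pp|pp] := boolP (prime p); last first.
  have l0 m : logn p m = 0%N by rewrite lognE (negPf pp).
  by rewrite !l0 minnn.
set k := minn _ _; rewrite -pfactor_dvdn ?absz_gt0//.
have hk (e : int) : e != 0 -> (k <= logn p `|e|)%N -> ((p ^ k)%N%:Z %| e)%Z.
  by move=> e0; rewrite -pfactor_dvdn ?absz_gt0.
have : ((p ^ k)%N%:Z %| a + b)%Z.
  by rewrite rpredD ?hk// geq_min leqnn ?orbT.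
by rewrite dvdzE.
Qed.

Lemma padic_abs_sub x y z :
  padic_abs (x - z) <= Num.max (padic_abs (x - y)) (padic_abs (y - z)).
Proof. by rewrite -(subrKA y x (- z)) padic_absD. Qed.

Lemma padic_absB x y : padic_abs (x - y) = padic_abs (y - x).
Proof. by rewrite -opprB padic_absN. Qed.

Lemma padic_abs_isosceles x y :
  padic_abs (x - y) < padic_abs y -> padic_abs x = padic_abs y.
Proof.
move=> h; apply/eqP; rewrite eq_le; apply/andP; split.
  have := padic_absD (x - y) y; rewrite subrK => /le_trans; apply.
  by rewrite ge_max lexx ltW.
have := padic_absD (y - x) x; rewrite subrK le_max => /orP[|//].
by rewrite padic_absB leNgt h.
Qed.
End PadicAbs.

Definition padic_cauchy (p : nat) (u : nat -> rat) : Prop :=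
  forall e : rat, 0 < e -> exists N, forall i j, (N <= i)%N -> (N <= j)%N ->
    padic_abs p (u i - u j) < e.

Definition padic_null (p : nat) (u : nat -> rat) : Prop :=
  forall e : rat, 0 < e -> exists N, forall i, (N <= i)%N ->
    padic_abs p (u i) < e.

Definition padic_cauchyb (p : nat) : {pred nat -> rat} :=
  fun u => `[< padic_cauchy p u >].

Section CauchyLemmas.
Variable p : nat.
Implicit Types u v : nat -> rat.

Lemma padic_cauchy_cst (c : rat) : padic_cauchy p (fun=> c).
Proof. by move=> e e0; exists 0%N => i j _ _; rewrite subrr padic_abs0. Qed.

Lemma padic_cauchyB u v : padic_cauchy p u -> padic_cauchy p v ->
  padic_cauchy p (u - v).
Proof.
move=> cu cv e e0; have [N hN] := cu e e0; have [M hM] := cv e e0.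
exists (maxn N M) => i j; rewrite !geq_max => /andP[Ni Mi] /andP[Nj Mj].
have -> : (u - v) i - (u - v) j = (u i - u j) + (v j - v i).
  by change (u i - v i - (u j - v j) = u i - u j + (v j - v i)); ring.
apply: le_lt_trans (padic_absD _ _ _) _.
by rewrite gt_max hN//= hM.
Qed.

Lemma padic_cauchy_bounded u : padic_cauchy p u ->
  exists2 C, 0 < C & exists N, forall i, (N <= i)%N -> padic_abs p (u i) < C.
Proof.
move=> /(_ 1 ltr01) [N hN]; exists (Num.max 1 (padic_abs p (u N)) + 1).
  by rewrite addr_gt0 ?lt_max ?ltr01.
exists N => i Ni; rewrite -(subrK (u N) (u i)).
apply: le_lt_trans (padic_absD _ _ _) _; rewrite gt_max; apply/andP; split.
  by rewrite (lt_le_trans (hN _ _ Ni (leqnn N)))// lerDr le_max ler01.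
by rewrite ltr_pwDr// le_max lexx orbT.
Qed.

Lemma padic_cauchyM u v : padic_cauchy p u -> padic_cauchy p v ->
  padic_cauchy p (u * v).
Proof.
move=> cu cv e e0.
have [C C0 [K hK]] := padic_cauchy_bounded cu.
have [D D0 [L hL]] := padic_cauchy_bounded cv.
have [N hN] := cu _ (divr_gt0 e0 D0); have [M hM] := cv _ (divr_gt0 e0 C0).
exists (maxn (maxn K L) (maxn N M)) => i j.
rewrite !geq_max => /andP[/andP[Ki Li] /andP[Ni Mi]].
move=> /andP[/andP[Kj Lj] /andP[Nj Mj]].
have -> : (u * v) i - (u * v) j = u i * (v i - v j) + (u i - u j) * v j.
  by change (u i * v i - u j * v j = u i * (v i - v j) + (u i - u j) * v j); ring.
apply: le_lt_trans (padic_absD _ _ _) _; rewrite gt_max !padic_absM.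
apply/andP; split.
  rewrite -[ltRHS](divfK (lt0r_neq0 C0)) [ltRHS]mulrC.
  by rewrite ltr_pM ?padic_abs_ge0 ?hK ?hM.
rewrite -[ltRHS](divfK (lt0r_neq0 D0)).
by rewrite ltr_pM ?padic_abs_ge0 ?hL ?hN.
Qed.

Lemma padic_cauchy_neq0 u : padic_cauchy p u -> ~ padic_null p u ->
  exists2 c, 0 < c & exists N, forall i, (N <= i)%N -> padic_abs p (u i) = c.
Proof.
move=> cu nu; have [e [e0 he]] : exists e : rat, 0 < e /\
    forall N, exists2 i, (N <= i)%N & e <= padic_abs p (u i).
  apply: contrapT => h; apply: nu => e e0; apply: contrapT => h'.
  apply: h; exists e; split=> // N; apply: contrapT => h''.
  apply: h'; exists N => i Ni; rewrite ltNge; apply/negP => ei.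
  by apply: h''; exists i.
have [N hN] := cu e e0; have [n Nn en] := he N.
exists (padic_abs p (u n)); first exact: lt_le_trans en.
exists N => i Ni; apply: padic_abs_isosceles.
exact: lt_le_trans (hN _ _ Ni Nn) en.
Qed.

Lemma padic_cauchyV u : padic_cauchy p u -> ~ padic_null p u ->
  padic_cauchy p (fun n => (u n)^-1).
Proof.
move=> cu nu e e0; have [c c0 [N hN]] := padic_cauchy_neq0 cu nu.
have [M hM] := cu (e * (c * c)) (mulr_gt0 e0 (mulr_gt0 c0 c0)).
exists (maxn N M) => i j; rewrite !geq_max => /andP[Ni Mi] /andP[Nj Mj].
have u0 k : (N <= k)%N -> u k != 0.
  by move=> Nk; rewrite -(padic_abs_eq0 p) hN// gt_eqF.
have -> : (u i)^-1 - (u j)^-1 = (u j - u i) * (u i * u j)^-1.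
  by field; rewrite !u0.
by rewrite padic_absM padic_absV padic_absM !hN// ltr_pdivrMr ?hM ?mulr_gt0.
Qed.

Lemma padic_nullD u v : padic_null p u -> padic_null p v -> padic_null p (u + v).
Proof.
move=> cu cv e e0; have [N hN] := cu e e0; have [M hM] := cv e e0.
exists (maxn N M) => i; rewrite !geq_max => /andP[Ni Mi].
by apply: le_lt_trans (padic_absD _ _ _) _; rewrite gt_max hN//= hM.
Qed.

Lemma padic_nullM u v : padic_cauchy p u -> padic_null p v ->
  padic_null p (u * v).
Proof.
move=> cu nv e e0; have [C C0 [K hK]] := padic_cauchy_bounded cu.
have [N hN] := nv _ (divr_gt0 e0 C0).
exists (maxn K N) => i; rewrite !geq_max => /andP[Ki Ni].
rewrite padic_absM -[ltRHS](divfK (lt0r_neq0 C0)) [ltRHS]mulrC.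
by rewrite ltr_pM ?padic_abs_ge0 ?hK ?hN.
Qed.

Lemma padic_cauchyb_subring : subring_closed (padic_cauchyb p).
Proof.
split=> [|u v /asboolP cu /asboolP cv|u v /asboolP cu /asboolP cv].
- by apply/asboolP; exact: padic_cauchy_cst.
- by apply/asboolP; exact: padic_cauchyB.
- by apply/asboolP; exact: padic_cauchyM.
Qed.

HB.instance Definition _ :=
  GRing.isSubringClosed.Build (nat -> rat) (padic_cauchyb p)
    padic_cauchyb_subring.
End CauchyLemmas.

Record padic_cauchy_seq (p : nat) := PadicCauchySeq {
  cauchy_seq_val :> nat -> rat;
  _ : cauchy_seq_val \in padic_cauchyb p
}.

Section CauchyRing.
Variable p : nat.
Notation C := (padic_cauchy_seq p).

HB.instance Definition _ := [isSub for @cauchy_seq_val p].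
HB.instance Definition _ := [Choice of C by <:].
HB.instance Definition _ := [SubChoice_isSubComNzRing of C by <:].

Lemma cauchy_seqP (u : C) : padic_cauchy p u.
Proof. by apply/asboolP; exact: (valP u). Qed.

Definition padic_nullb : {pred C} := fun u : C => `[< padic_null p u >].

Lemma padic_nullb_idealr : idealr_closed padic_nullb.
Proof.
split=> [||a u v /asboolP nu /asboolP nv].
- apply/asboolP => e e0; exists 0%N => i _; rewrite (_ : _ i = 0) ?padic_abs0//.
- apply/negP => /asboolP /(_ 1 ltr01) [N /(_ N (leqnn N))].
  by rewrite (_ : _ N = 1)// padic_abs1 ltxx.
- apply/asboolP; rewrite (_ : _ (a * u + v) = (a : nat -> rat) * u + v)//.
  by apply: padic_nullD => //; apply: padic_nullM => //; exact: cauchy_seqP.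
Qed.

HB.instance Definition _ := isIdealr.Build C padic_nullb padic_nullb_idealr.
End CauchyRing.

(* The completion of [rat] for [padic_abs p]: Cauchy sequences modulo null
   sequences. *)
Definition Qp (p : nat) := {ideal_quot (@padic_nullb p)}.

Section QpField.
Local Open Scope quotient_scope.
Variable p : nat.
Notation C := (padic_cauchy_seq p).
Notation Q := {ideal_quot (@padic_nullb p)}.

HB.instance Definition _ := GRing.ComNzRing.copy (Qp p) Q.

Definition Qp_class (u : C) : Qp p := \pi_Q u.
Definition Qp_repr (x : Qp p) : C := repr (x : Q).

Lemma Qp_reprK : cancel Qp_repr Qp_class. Proof. exact: reprK. Qed.

Lemma Qp_class_is_zmod_morphism : zmod_morphism Qp_class.
Proof. exact: (rmorphB (\pi_Q)). Qed.

Lemma Qp_class_is_monoid_morphism : monoid_morphism Qp_class.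
Proof. by split; [exact: (rmorph1 (\pi_Q)) | exact: (rmorphM (\pi_Q))]. Qed.

HB.instance Definition _ := GRing.isZmodMorphism.Build C (Qp p) Qp_class
  Qp_class_is_zmod_morphism.
HB.instance Definition _ := GRing.isMonoidMorphism.Build C (Qp p) Qp_class
  Qp_class_is_monoid_morphism.

Lemma Qp_class_eq0 (u : C) : Qp_class u = 0 <-> padic_null p u.
Proof.
have -> : (Qp_class u = 0) <-> (u \in @padic_nullb p).
  rewrite -[u in u \in _]subr0 Quotient.idealrBE -(rmorph0 Qp_class).
  by split => [/eqP//|/eqP].
by split => /asboolP.
Qed.

Lemma Qp_classP (x : Qp p) : exists u : C, x = Qp_class u.
Proof. by exists (Qp_repr x); rewrite Qp_reprK. Qed.

Lemma Qp_inv_ex (x : Qp p) : exists y : Qp p, x != 0 -> y * x = 1.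
Proof.
have [->|x0] := eqVneq x 0; first by exists 0.
have [u ux] := Qp_classP x.
have nu : ~ padic_null p u by move=> /Qp_class_eq0; rewrite -ux => /eqP; apply/negP.
have cV : (fun n => (u n)^-1) \in padic_cauchyb p.
  by apply/asboolP; apply: padic_cauchyV => //; exact: cauchy_seqP.
exists (Qp_class (PadicCauchySeq cV)) => _; rewrite ux -rmorphM.
apply/eqP; rewrite -subr_eq0 -(rmorph1 Qp_class) -rmorphB.
apply/eqP/Qp_class_eq0 => e e0.
have [c c0 [N hN]] := padic_cauchy_neq0 (cauchy_seqP u) nu.
exists N => i Ni; rewrite (_ : _ i = (u i)^-1 * u i - 1)//.
rewrite mulVf ?subrr ?padic_abs0//.
by rewrite -(padic_abs_eq0 p) hN// gt_eqF.
Qed.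

Definition Qp_inv (x : Qp p) : Qp p :=
  if x == 0 then 0 else sval (cid (Qp_inv_ex x)).

Lemma Qp_mulVf x : x != 0 -> Qp_inv x * x = 1.
Proof. by rewrite /Qp_inv; case: cid => y /= h x0; rewrite (negPf x0) h. Qed.

Lemma Qp_inv0 : Qp_inv 0 = 0. Proof. by rewrite /Qp_inv; case: cid => y /= _; rewrite eqxx. Qed.

HB.instance Definition _ := GRing.ComNzRing_isField.Build (Qp p)
  Qp_mulVf Qp_inv0.

Lemma padic_cauchyb_cst (c : rat) : (fun=> c) \in padic_cauchyb p.
Proof. by apply/asboolP; exact: padic_cauchy_cst. Qed.

Definition Qp_of_rat (c : rat) : Qp p :=
  Qp_class (PadicCauchySeq (padic_cauchyb_cst c)).

Lemma Qp_of_rat_is_zmod_morphism : zmod_morphism Qp_of_rat.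
Proof. by move=> a b; rewrite /Qp_of_rat -rmorphB; congr Qp_class; exact: val_inj. Qed.

Lemma Qp_of_rat_is_monoid_morphism : monoid_morphism Qp_of_rat.
Proof.
split; first by rewrite -(rmorph1 Qp_class); congr Qp_class; exact: val_inj.
by move=> a b; rewrite /Qp_of_rat -rmorphM; congr Qp_class; exact: val_inj.
Qed.

HB.instance Definition _ := GRing.isZmodMorphism.Build rat (Qp p) Qp_of_rat
  Qp_of_rat_is_zmod_morphism.
HB.instance Definition _ := GRing.isMonoidMorphism.Build rat (Qp p) Qp_of_rat
  Qp_of_rat_is_monoid_morphism.

(* [padic_abs p] is eventually constant along a Cauchy sequence that does not
   tend to 0; a null sequence either has no eventual value (default 0) or the
   eventual value 0. The extended absolute value thus stays rational. *)
Definition Qp_abs (x : Qp p) : rat :=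
  xget 0 [set a | exists N, forall n, (N <= n)%N ->
                    padic_abs p (Qp_repr x n) = a].

Lemma Qp_abs_class (u : C) (a : rat) :
  (exists N, forall n, (N <= n)%N -> padic_abs p (u n) = a) ->
  Qp_abs (Qp_class u) = a.
Proof.
move=> [N hN]; set v := Qp_repr (Qp_class u).
have uv : padic_null p (v - u).
  by apply/(Qp_class_eq0 (v - u)); rewrite rmorphB /= Qp_reprK subrr.
have uniq b : (exists N, forall n, (N <= n)%N -> padic_abs p (v n) = b) -> b = a.
  move=> [M hM].
  have close e : 0 < e -> exists2 n, (maxn N M <= n)%N & padic_abs p (v n - u n) < e.
    move=> /uv[K hK]; exists (maxn K (maxn N M)); first exact: leq_maxr.
    by apply: hK; exact: leq_maxl.
  have [a0|a0] := ltP 0 a.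
    have [n + h] := close _ a0; rewrite geq_max => /andP[Nn Mn].
    rewrite -(hM _ Mn) -(hN _ Nn); apply: padic_abs_isosceles.
    by rewrite hN.
  have {}a0 : a = 0.
    by apply/eqP; rewrite eq_le a0 -(hN N)// padic_abs_ge0.
  have [b0|b0] := ltP 0 b.
    have [n + h] := close _ b0; rewrite geq_max => /andP[Nn Mn].
    rewrite -(hM _ Mn) -(hN _ Nn); apply/esym; apply: padic_abs_isosceles.
    by rewrite padic_absB hM.
  by rewrite a0; apply/eqP; rewrite eq_le b0 -(hM M)// padic_abs_ge0.
rewrite /Qp_abs; case: xgetP => [b _ /uniq//|no].
have [nu|nu] := pselect (padic_null p u).
  apply/eqP; rewrite eq_le; apply/andP; split.
    by rewrite -(hN N)// padic_abs_ge0.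
  rewrite leNgt; apply/negP => /nu[M hM].
  have := hM _ (leq_maxr N M); rewrite (hN _ (leq_maxl _ _)).
  by rewrite ltxx.
have nv : ~ padic_null p v.
  by move=> /Qp_class_eq0; rewrite Qp_reprK => /Qp_class_eq0.
have [c _ hc] := padic_cauchy_neq0 (cauchy_seqP v) nv.
by have := no c hc.
Qed.

Lemma Qp_abs_of_rat c : Qp_abs (Qp_of_rat c) = padic_abs p c.
Proof. by apply: Qp_abs_class; exists 0%N. Qed.

Lemma Qp_abs0 : Qp_abs 0 = 0.
Proof. by rewrite -(rmorph0 Qp_of_rat) Qp_abs_of_rat padic_abs0. Qed.

Lemma Qp_absP (x : Qp p) : x != 0 -> exists u : C, [/\ x = Qp_class u,
  0 < Qp_abs x &
  exists N, forall n, (N <= n)%N -> padic_abs p (u n) = Qp_abs x].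
Proof.
move=> x0; have [u ux] := Qp_classP x; exists u.
have nu : ~ padic_null p u by move=> /Qp_class_eq0; rewrite -ux => /eqP; apply/negP.
have [c c0 hc] := padic_cauchy_neq0 (cauchy_seqP u) nu.
by have := Qp_abs_class hc; rewrite -ux => ->; split.
Qed.

Lemma Qp_abs_ge0 x : 0 <= Qp_abs x.
Proof.
by have [->|/Qp_absP[u [_ /ltW]]//] := eqVneq x 0; rewrite Qp_abs0.
Qed.

Lemma Qp_abs_eq0 x : (Qp_abs x == 0) = (x == 0).
Proof.
have [->|/Qp_absP[u [_ /gt_eqF]]//] := eqVneq x 0; by rewrite Qp_abs0 eqxx.
Qed.

Lemma Qp_absM x y : Qp_abs (x * y) = Qp_abs x * Qp_abs y.
Proof.
have [->|x0] := eqVneq x 0; first by rewrite mul0r Qp_abs0 mul0r.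
have [->|y0] := eqVneq y 0; first by rewrite mulr0 Qp_abs0 mulr0.
have [u [ux _ [N hN]]] := Qp_absP x0; have [v [vy _ [M hM]]] := Qp_absP y0.
rewrite {1}ux {1}vy -rmorphM; apply: Qp_abs_class.
exists (maxn N M) => n; rewrite geq_max => /andP[Nn Mn].
by rewrite (_ : _ n = u n * v n)// padic_absM hN// hM.
Qed.

Lemma Qp_absD x y : Qp_abs (x + y) <= Num.max (Qp_abs x) (Qp_abs y).
Proof.
have [->|x0] := eqVneq x 0; first by rewrite add0r le_max lexx orbT.
have [->|y0] := eqVneq y 0; first by rewrite addr0 le_max lexx.
have [->|xy0] := eqVneq (x + y) 0; first by rewrite Qp_abs0 le_max Qp_abs_ge0.
have [u [ux _ [N hN]]] := Qp_absP x0; have [v [vy _ [M hM]]] := Qp_absP y0.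
have [w [wxy _ [K hK]]] := Qp_absP xy0.
have [L hL] : exists L, forall n, (L <= n)%N ->
    padic_abs p ((u + v) n) = Qp_abs (x + y).
  have nuv : ~ padic_null p (u + v).
    move=> /(Qp_class_eq0 (u + v)) h; move/eqP: xy0; apply.
    by rewrite ux vy -rmorphD.
  have [c _ [L hL]] := padic_cauchy_neq0 (cauchy_seqP (u + v)) nuv.
  by exists L => n Ln; rewrite hL// ux vy -rmorphD; apply/esym/Qp_abs_class; exists L.
pose n := maxn L (maxn N M).
rewrite -(hL n) ?leq_maxl// -(hN n) ?leq_max ?leqnn ?orbT//.
by rewrite -(hM n) ?leq_max ?leqnn ?orbT// padic_absD.
Qed.

Lemma Qp_absN x : Qp_abs (- x) = Qp_abs x.
Proof.
rewrite -mulN1r Qp_absM -(rmorph1 Qp_of_rat) -rmorphN Qp_abs_of_rat.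
by rewrite padic_absN padic_abs1 mul1r.
Qed.

Definition Qp_dist (x y : Qp p) : rat := Qp_abs (x - y).

Lemma Qp_distxx x : Qp_dist x x = 0.
Proof. by rewrite /Qp_dist subrr Qp_abs0. Qed.

Lemma Qp_dist_eq0 x y : Qp_dist x y = 0 -> x = y.
Proof. by move/eqP; rewrite Qp_abs_eq0 subr_eq0 => /eqP. Qed.

Lemma Qp_dist_sym x y : Qp_dist x y = Qp_dist y x.
Proof. by rewrite /Qp_dist -opprB Qp_absN. Qed.

Lemma Qp_dist_triangle y x z : Qp_dist x z <= Qp_dist x y + Qp_dist y z.
Proof.
rewrite /Qp_dist -(subrKA y x (- z)); apply: le_trans (Qp_absD _ _) _.
by rewrite ge_max lerDl lerDr !Qp_abs_ge0.
Qed.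

HB.instance Definition _ := isPointed.Build (Qp p) 0.
HB.instance Definition _ := isMetric.Build rat (Qp p)
  Qp_distxx Qp_dist_eq0 Qp_dist_sym Qp_dist_triangle.

Lemma Qp_class_cvg (u : C) : Qp_of_rat (u n) @[n --> \oo] --> Qp_class u.
Proof.
apply/cvg_ballP => e e0; have [N hN] := cauchy_seqP u e0.
exists N => // n /= Nn; rewrite ballEmdist /=.
change (Qp_abs (Qp_class u - Qp_of_rat (u n)) < e).
set v : C := u - PadicCauchySeq (padic_cauchyb_cst (u n)).
have -> : Qp_class u - Qp_of_rat (u n) = Qp_class v by rewrite rmorphB.
have [/Qp_class_eq0 ->|nv] := pselect (padic_null p v); first by rewrite Qp_abs0.
have [c _ [K hK]] := padic_cauchy_neq0 (cauchy_seqP v) nv.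
rewrite (_ : Qp_abs _ = c); last by apply: Qp_abs_class; exists K.
rewrite -(hK (maxn N K)) ?leq_maxr// (_ : v _ = u (maxn N K) - u n)//.
by apply: hN => //; exact: leq_maxl.
Qed.
End QpField.

Definition Qp_lin_indep (p : nat) (I : finType) (v : I -> Qp p) : Prop :=
  forall c : I -> rat,
    \sum_i Qp_of_rat p (c i) * v i = 0 -> forall i, c i = 0.

(* A power series [\sum_k g_k z^k] is the sequence [g : nat -> rat]; its sum
   and difference are pointwise, but its product is not the pointwise one. *)
Section FormalPowerSeries.
Implicit Types (f g h : nat -> rat) (k n : nat) (a y : rat).

Definition fps_one : nat -> rat := fun k => (k == 0%N)%:R.
Definition fps_mul f g : nat -> rat :=
  fun k => \sum_(i < k.+1) f i * g (k - i)%N.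
Definition fps_pow f n : nat -> rat := iter n (fps_mul f) fps_one.

(* [g(h(z))] when [h 0 = 0]: then [z^k] does not occur in [h^j] for [j > k]. *)
Definition fps_comp g h : nat -> rat :=
  fun k => \sum_(j < k.+1) g j * fps_pow h j k.

(* [f(z) / z] when [f 0 = 0]. *)
Definition fps_divz f : nat -> rat := fun k => f k.+1.

(* [1 / f] when [f 0 = 1], as the geometric series in [1 - f]. *)
Definition fps_inv f : nat -> rat := fps_comp (fun=> 1) (fps_one - f).

Definition fps_exp a : nat -> rat := fun k => a ^+ k / k`!%:R.
Definition fps_expm1 : nat -> rat := fps_exp 1 - fps_one.
Definition fps_binom a : nat -> rat :=
  fun k => (\prod_(j < k) (a - j%:R)) / k`!%:R.
Definition fps_log1p : nat -> rat :=
  fun k => if k is k'.+1 then (-1) ^+ k' / k%:R else 0.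

Lemma fps_pow_ltn h j k : h 0%N = 0 -> (k < j)%N -> fps_pow h j k = 0.
Proof.
move=> h0; elim: j k => // j IHj k kj; rewrite /fps_pow /= -/(fps_pow h j).
rewrite /fps_mul big1// => -[[|i] /= ik] _; first by rewrite h0 mul0r.
rewrite IHj ?mulr0//; rewrite ltnS in kj; apply: leq_trans kj.
by rewrite ltn_subrL /=; move: ik; rewrite ltnS; exact: leq_trans.
Qed.

Lemma fps_mulC f g : fps_mul f g = fps_mul g f.
Proof.
apply/funext => k; rewrite /fps_mul (reindex_inj rev_ord_inj) /=.
apply: eq_bigr => i _; rewrite subSS subKn; first exact: mulrC.
by rewrite -ltnS.
Qed.

Let fps_mul_poly N f g k : (k < N)%N ->
  fps_mul f g k = ((\poly_(i < N) f i) * (\poly_(i < N) g i))`_k.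
Proof.
move=> kN; rewrite coefM; apply: eq_bigr => -[i /= ik] _; rewrite !coef_poly.
rewrite (leq_ltn_trans (leq_subr _ _) kN).
by rewrite (leq_ltn_trans _ kN).
Qed.

Lemma fps_mulA f g h : fps_mul f (fps_mul g h) = fps_mul (fps_mul f g) h.
Proof.
apply/funext => k.
pose F := \poly_(i < k.+1) f i; pose G := \poly_(i < k.+1) g i.
pose H := \poly_(i < k.+1) h i.
transitivity ((F * G * H)`_k).
  rewrite -mulrA coefM; apply: eq_bigr => -[i /= ik] _; rewrite coef_poly ik.
  by rewrite (@fps_mul_poly k.+1)// ltnS leq_subr.
rewrite coefM; apply: eq_bigr => -[i /= ik] _.
by rewrite coef_poly ltnS leq_subr (@fps_mul_poly k.+1).
Qed.

Lemma fps_mul1 f : fps_mul fps_one f = f.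
Proof.
apply/funext => k; rewrite /fps_mul big_ord_recl /= mul1r subn0.
by rewrite big1 ?addr0// => i _; rewrite mul0r.
Qed.

Lemma fps_mulBl f g h : fps_mul (f - g) h = fps_mul f h - fps_mul g h.
Proof.
apply/funext => k; rewrite [RHS](_ : _ = fps_mul f h k - fps_mul g h k)//.
by rewrite /fps_mul -sumrB; apply: eq_bigr => i _; rewrite -mulrBl.
Qed.

Lemma fps_mulV f : f 0%N = 1 -> fps_mul f (fps_inv f) = fps_one.
Proof.
move=> f0; apply/funext => k; pose h := fps_one - f.
have h0 : h 0%N = 0 by rewrite (_ : h 0%N = 1 - f 0%N)// f0 subrr.
have -> : fps_mul f (fps_inv f) k =
    \sum_(j < k.+1) fps_mul f (fps_pow h j) k.
  rewrite exchange_big /=; apply: eq_bigr => -[i /= ik] _.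
  rewrite -mulr_sumr; congr (_ * _); rewrite /fps_inv /fps_comp.
  rewrite (big_ord_widen_cond k.+1 xpredT
    (fun j => 1 * fps_pow (fps_one - f) j (k - i)%N)) /= ?ltnS ?leq_subr//.
  rewrite big_mkcond /=; apply: eq_bigr => -[j /= jk] _; rewrite mul1r.
  by case: ifPn => //; rewrite -leqNgt => /fps_pow_ltn ->.
have tele j : fps_mul f (fps_pow h j) k = fps_pow h j k - fps_pow h j.+1 k.
  have -> : fps_pow h j.+1 = fps_mul (fps_one - f) (fps_pow h j) by [].
  rewrite fps_mulBl fps_mul1.
  rewrite [X in _ - X](_ : _ = fps_pow h j k - fps_mul f (fps_pow h j) k)//.
  by rewrite opprB addrCA subrr addr0.
under eq_bigr do rewrite tele.
rewrite -(big_mkord xpredT (fun j => fps_pow h j k - fps_pow h j.+1 k)).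
rewrite (@telescope_sumr_eq _ 0 k.+1 (fun j => - fps_pow h j k))//; last first.
  by move=> j _; rewrite opprK addrC.
by rewrite fps_pow_ltn// oppr0 sub0r opprK.
Qed.

(* [B_k(y)], from [e^{yz} / ((e^z - 1) / z) = \sum_k B_k(y) z^k / k!]. *)
Definition bernoulli k y : rat :=
  k`!%:R * fps_mul (fps_exp y) (fps_inv (fps_divz fps_expm1)) k.

Lemma bernoulli_gen y :
  fps_mul fps_expm1 (fun k => bernoulli k y / k`!%:R) =
  (fun k => if k is k'.+1 then fps_exp y k' else 0).
Proof.
pose E := fps_divz fps_expm1.
have -> : (fun k => bernoulli k y / k`!%:R) = fps_mul (fps_exp y) (fps_inv E).
  apply/funext => k; have k0 : k`!%:R != 0 :> rat.
    by rewrite pnatr_eq0 -lt0n fact_gt0.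
  by rewrite /bernoulli mulrC mulKf.
have e0 : fps_expm1 0%N = 0.
  by rewrite (_ : fps_expm1 0%N = 1 / 1%:R - 1)// divr1 subrr.
have E0 : E 0%N = 1.
  by rewrite (_ : E 0%N = 1 ^+ 1 / 1%:R - 0)// subr0 divr1 expr1.
apply/funext => -[|k]; rewrite /fps_mul big_ord_recl e0 mul0r ?big_ord0 ?addr0//.
rewrite add0r -[LHS]/(fps_mul E (fps_mul (fps_exp y) (fps_inv E)) k).
by rewrite [fps_mul (fps_exp y) _]fps_mulC fps_mulA fps_mulV// fps_mul1.
Qed.

(* [mellin_inv g k] is the coefficient of [z^(-k-1)] in the modified inverse
   Mellin transform of [g]. *)
Definition mellin_inv g : nat -> rat :=
  fun k => (-1) ^+ k.+1 * (k`!%:R * fps_comp g fps_expm1 k).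

(* The formal series [R_(a,s)], by its coefficients of [z^(-k-1)]. *)
Definition Rformal a (s : nat) : nat -> rat :=
  mellin_inv (fps_divz (if s == 1%N then fps_binom a - fps_one
                        else fps_mul (fps_binom a) (fps_pow fps_log1p s.-1))).
End FormalPowerSeries.

(* In [{poly {poly rat}}] the outer variable is [t] and the coefficients are
   polynomials in [z]; [phi f] sends [t^k] to [f k] and is linear over
   polynomials in [z]. *)
Definition phi (f : nat -> rat) (S : {poly {poly rat}}) : {poly rat} :=
  \sum_(k < size S) f k *: S`_k.

(* [(P(z) - P(t)) / (z - t)] *)
Definition div_diff (P : {poly rat}) : {poly {poly rat}} :=
  (P%:P - P^:P) %/ ('X%:P - 'X).

Lemma div_diffK (P : {poly rat}) : div_diff P * ('X%:P - 'X) = P%:P - P^:P.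
Proof.
have [q hq] : exists q, P%:P - P^:P = q * ('X - 'X%:P).
  apply/factor_theorem; apply/eqP.
  by rewrite hornerD hornerN hornerC -/(P \Po 'X) comp_polyXr subrr.
rewrite /div_diff; have -> : P%:P - P^:P = (- q) * ('X%:P - 'X) by rewrite mulNr -mulrN opprB hq.
rewrite Pdiv.IdomainUnit.mulpK// -opprB lead_coefN lead_coefXsubC.
by rewrite unitrN1.
Qed.

Definition rising (A : nzRingType) (a : A) (n : nat) : A :=
  \prod_(j < n) (a + j%:R).

Definition Delta_m1 (P : {poly rat}) : {poly rat} := P \Po ('X - 1) - P.

Section Approximants.
Variables (d : nat) (m : 'I_d -> nat) (alpha : 'I_d -> rat).

(* The pair [(i, s)] is encoded by [i - 1] and [s - 1]. *)
Definition index_set := {u : {i : 'I_d & 'I_(m i).+1} |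
  ~~ ((tag u == 0%N :> nat) && (tagged u == 0%N :> nat))}.
Definition idx_i (u : index_set) : 'I_d := tag (val u).
Definition idx_s (u : index_set) : nat := (tagged (val u)).+1.

Definition Mtot : nat := (\sum_i m i + d - 1)%N.

Definition Apoly (n l : nat) : {poly rat} :=
  ((-1) ^+ l / l`!%:R) *: rising 'X l *
  \prod_(i < d) (((-1) ^+ n / n`!%:R) *: rising ('X + (alpha i)%:P) n)
                  ^+ (m i).+1.

Definition Ppoly (n l : nat) : {poly rat} := iter n Delta_m1 (Apoly n l).

Definition Qpoly (n : nat) (i : 'I_d) (s l : nat) : {poly rat} :=
  phi (Rformal (alpha i) s) (div_diff (Ppoly n l)).

Definition Rterm1 (a x : rat) (k : nat) : rat :=
  (bernoulli k.+1 a - bernoulli k.+1 0) / k.+1%:R * ((-1) ^+ k.+1 / x ^+ k.+1).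

Definition Rterm (a x : rat) (s k : nat) : rat :=
  rising (k + 3 - s)%:R (s - 2) * bernoulli (k + 2 - s) 0 *
  ((-1) ^+ k.+1 / (x + a) ^+ k.+1).

Definition Rvalue (p : nat) (a : rat) (s : nat) (x : rat) : Qp p :=
  if s == 1%N then limn (fun N => \sum_(0 <= k < N) Qp_of_rat p (Rterm1 a x k))
  else limn (fun N => \sum_((s - 2)%N <= k < N) Qp_of_rat p (Rterm a x s k)).

Definition Rfrak (p n : nat) (i : 'I_d) (s l : nat) (x : rat) : Qp p :=
  Qp_of_rat p (Ppoly n l).[x] * Rvalue p (alpha i) s x -
  Qp_of_rat p (Qpoly n i s l).[x].
End Approximants.

(* [limsup_n (a_n)^(1/n)] for nonnegative [a]; the exponent at [n = 0] is 0. *)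
Definition limsup_root (R : realType) (a : nat -> rat) : \bar R :=
  limn_esup (fun n => (ratr (a n) `^ n%:R^-1)%:E).

Definition q_ (p : nat) : nat := if p == 2%N then 4%N else p.

(* Main.v *)
(* For rational [c], the forms [c_0 P_{n,l}(x) + sum_u c_u Q_{n,u,l}(x)] equal
   [- sum_u c_u R_{n,u,l}(x)] in [Qp p] when [c] is a linear relation. Cleared
   of denominators they are rational integers [N] with [|N| |N|_p < 1] for
   large [n], hence zero, so it is enough that the square matrix of the
   [P_{n,l}(x)] and [Q_{n,u,l}(x)] is invertible for every [n].

   Substituting [e^z - 1] for the variable turns [(1 + z)^a] and [log(1 + z)]
   into [e^{az}] and [z], and multiplying by [e^z - 1] is dual to [Delta_{-1}];
   hence [phi_{a,s}(Delta C) = (-1)^s C^{(s-1)}(-a)] for [s >= 2], and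
   [phi_{a,1}(Delta C) = C(0) - C(-a)]. If a combination [P] of the [P_{n,l}]
   and the matching combinations of the [Q_{n,u,l}] vanish at [x], then
   [P = (z - x) S] with [phi_u(S) = 0]; since [phi_u(q P) = 0] for [deg q < n],
   [phi_u(q S) = 0] for [deg q <= n]. Summation by parts then gives
   [S = Delta^{n+1} C] where [C] vanishes to order [m_i + 1] at each
   [-alpha_i - j], [0 <= j <= n]. These are more zeros than the degree of [C]
   allows, so [C = 0] and [P = 0]. *)

From HB Require Import structures.
Require Import Defs.
From mathcomp Require Import all_boot all_order all_algebra.
From mathcomp Require Import all_classical all_reals all_analysis.
From mathcomp Require Import ring lra zify.

Set Implicit Arguments.
Unset Strict Implicit.
Unset Printing Implicit Defensive.
Import Order.TTheory GRing.Theory Num.Theory.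
Local Open Scope ring_scope.

(** * Composition of formal power series *)

Section FormalPowerSeriesComposition.
Implicit Types (f g h : nat -> rat) (a : rat) (p : {poly rat}).

(** Coefficients below order [N] only see truncations at [N], so identities between power series can
    be imported from [{poly rat}]. *)
Lemma coef_polyM_fps N f g k : (k < N)%N ->
  (\poly_(i < N) f i * \poly_(i < N) g i)`_k = fps_mul f g k.
Proof.
move=> kN; rewrite coefM; apply: eq_bigr => -[i /= ik] _; rewrite !coef_poly.
by rewrite (leq_ltn_trans (leq_subr _ _) kN) (leq_ltn_trans _ kN).
Qed.

Lemma coef_exp_fps N h j k : (k < N)%N ->
  ((\poly_(i < N) h i) ^+ j)`_k = fps_pow h j k.
Proof.
elim: j k => [|j IHj] k kN; first by rewrite expr0 coef1.
rewrite exprS coefM; apply: eq_bigr => -[i /= ik] _.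
by rewrite coef_poly IHj ?(leq_ltn_trans (leq_subr _ _) kN)// (leq_ltn_trans _ kN).
Qed.

(** As [h] has no constant term, [h^j] starts at order [j]; hence only the coefficients of [p] up to
    [k] matter, and any long enough truncation of [g] will do. *)
Lemma coef_comp_fps N p g h k : h 0%N = 0 -> (k < N)%N ->
  (forall j, (j <= k)%N -> p`_j = g j) ->
  (p \Po \poly_(i < N) h i)`_k = fps_comp g h k.
Proof.
move=> h0 kN pg; rewrite coef_comp_poly /fps_comp.
pose K := maxn (size p) k.+1.
rewrite (big_ord_widen K (fun i => p`_i * ((\poly_(j < N) h j) ^+ i)`_k)) ?leq_maxl//.
rewrite (big_ord_widen K (fun i => g i * fps_pow h i k)) ?leq_maxr//.
rewrite big_mkcond [RHS]big_mkcond; apply: eq_bigr => -[i /= iK] _.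
rewrite coef_exp_fps//; have [ik|ki] := leqP i k.
  rewrite ltnS ik -pg//; case: ltnP => // /(nth_default 0) ->.
  by rewrite mul0r.
by rewrite fps_pow_ltn// !mulr0 !if_same.
Qed.

Lemma fps_compM f g h : h 0%N = 0 ->
  fps_comp (fps_mul f g) h = fps_mul (fps_comp f h) (fps_comp g h).
Proof.
move=> h0; apply/funext => k.
pose F := \poly_(i < k.+1) f i; pose G := \poly_(i < k.+1) g i.
rewrite -(@coef_comp_fps k.+1 (F * G))//; last first.
  by move=> j jk; rewrite coef_polyM_fps.
rewrite comp_polyM coefM; apply: eq_bigr => -[i /= ik] _.
congr (_ * _); apply: coef_comp_fps; rewrite ?ltnS ?leq_subr// => j jk.
  by rewrite coef_poly ltnS (leq_trans jk).
by rewrite coef_poly ltnS (leq_trans jk (leq_subr _ _)).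
Qed.

Lemma fps_comp_one h : fps_comp fps_one h = fps_one.
Proof.
apply/funext => k; rewrite /fps_comp big_ord_recl mul1r big1 ?addr0// => i _.
by rewrite mul0r.
Qed.

Lemma fps_compB f g h : fps_comp (f - g) h = fps_comp f h - fps_comp g h.
Proof.
apply/funext => k; rewrite [RHS](_ : _ = fps_comp f h k - fps_comp g h k)//.
by rewrite /fps_comp -sumrB; apply: eq_bigr => i _; rewrite -mulrBl.
Qed.

Lemma fps_comp_pow f h n : h 0%N = 0 ->
  fps_comp (fps_pow f n) h = fps_pow (fps_comp f h) n.
Proof.
by move=> h0; elim: n => [|n IHn]; rewrite ?fps_comp_one//= fps_compM// IHn.
Qed.

(** This is [z * (g / z) = g] with [h] substituted for [z]. For [h = e^z - 1] it removes the
    division by [z] in [Rformal]. *)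
Lemma fps_mul_comp_divz g h : g 0%N = 0 -> h 0%N = 0 ->
  fps_mul h (fps_comp (fps_divz g) h) = fps_comp g h.
Proof.
move=> g0 h0; apply/funext => k.
pose G := \poly_(i < k.+1) fps_divz g i; pose H := \poly_(i < k.+1) h i.
transitivity ((('X * G) \Po H)`_k); last first.
  apply: coef_comp_fps => // -[|j] jk; rewrite coefXM//= coef_poly.
  by rewrite ltnS (ltnW jk).
rewrite comp_polyM comp_polyX coefM; apply: eq_bigr => -[i /= ik] _.
rewrite coef_poly ik; congr (_ * _).
rewrite (@coef_comp_fps k.+1 _ (fps_divz g)) ?ltnS ?leq_subr// => j jk.
by rewrite coef_poly ltnS (leq_trans jk (leq_subr _ _)).
Qed.

Lemma fps_pow_X n :
  fps_pow (fun k => (k == 1%N)%:R) n = (fun k => (k == n)%:R).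
Proof.
apply/funext => k; rewrite -(@coef_exp_fps k.+2)//.
rewrite (_ : \poly_(_ < _) _ = 'X) ?coefXn//.
by apply/polyP => -[|[|i]]; rewrite coef_poly coefX//= if_same.
Qed.

(** * Exponential, binomial and logarithm series under the substitution of [e^z - 1] *)

Lemma fps_expD a b : fps_mul (fps_exp a) (fps_exp b) = fps_exp (a + b).
Proof.
apply/funext => k; rewrite /fps_exp /fps_mul addrC exprDn mulr_suml.
apply: eq_bigr => -[i /= ik] _; rewrite ltnS in ik.
rewrite -mulr_natr -(bin_fact ik) !natrM.
have f0 n : n`!%:R != 0 :> rat by rewrite pnatr_eq0 -lt0n fact_gt0.
have c0 : 'C(k, i)%:R != 0 :> rat by rewrite pnatr_eq0 -lt0n bin_gt0.
by field; rewrite !f0 c0.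
Qed.

Lemma fps_expm1_0 : fps_expm1 0%N = 0.
Proof. by rewrite (_ : fps_expm1 0%N = 1 / 1%:R - 1)// divr1 subrr. Qed.

(** The binomial coefficient as a polynomial in its upper argument, so that identities known for
    natural exponents extend to rational ones. *)
Definition binom_poly (j : nat) : {poly rat} :=
  j`!%:R^-1 *: \prod_(i < j) ('X - i%:R%:P).

Lemma horner_binom_poly j a : (binom_poly j).[a] = fps_binom a j.
Proof.
rewrite hornerZ horner_prod mulrC; congr (_ / _).
by apply: eq_bigr => i _; rewrite hornerXsubC.
Qed.

(** The derivative of [(1 + z)^a] in [a] at [a = 0] is [log(1 + z)]. *)
Lemma coef1_binom_poly j : (binom_poly j)`_1 = fps_log1p j.
Proof.
case: j => [|j]; first by rewrite /binom_poly big_ord0 coefZ coef1 mulr0.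
rewrite coefZ big_ord_recl subr0 coefXM /= -horner_coef0 horner_prod.
rewrite (eq_bigr (fun i : 'I_j => -1 * i.+1%:R)); last first.
  by move=> i _; rewrite hornerXsubC sub0r mulN1r.
rewrite big_split prodr_const card_ord -natr_prod /=.
have -> : (\prod_(i < j) i.+1 = j`!)%N by rewrite fact_prod big_add1 big_mkord.
rewrite factS natrM.
have f0 : j`!%:R != 0 :> rat by rewrite pnatr_eq0 -lt0n fact_gt0.
by field; rewrite f0 nat1r pnatr_eq0.
Qed.

(** Pascal's rule, in the form [(1 + z)^(a+1) = (1 + z) (1 + z)^a]. *)
Lemma fps_binomS a :
  fps_binom (a + 1) = fps_mul (fps_binom 1) (fps_binom a).
Proof.
have b1 k : fps_binom 1 k = (k <= 1)%:R.
  case: k => [|[|k]]; rewrite /fps_binom.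
  - by rewrite big_ord0 divr1.
  - by rewrite big_ord_recl big_ord0 subr0 mulr1.
  - by rewrite 2!big_ord_recl /= subrr mul0r mulr0 mul0r.
apply/funext => -[|k].
  by rewrite /fps_mul big_ord_recl big_ord0 b1 /fps_binom !big_ord0 mul1r addr0.
rewrite /fps_mul 2!big_ord_recl big1 ?addr0; last first.
  by move=> i _; rewrite b1 mul0r.
rewrite !b1 !mul1r subn0 subn1 /fps_binom.
rewrite big_ord_recl [in X in _ = X + _]big_ord_recr /= subr0.
rewrite (eq_bigr (fun i : 'I_k => a - i%:R)); last first.
  by move=> i _; rewrite /bump /= add1n -natr1; ring.
rewrite factS natrM.
have f0 : k`!%:R != 0 :> rat by rewrite pnatr_eq0 -lt0n fact_gt0.
rewrite -natr1; field; rewrite f0 natr1 pnatr_eq0//.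
Qed.

Lemma fps_comp_binom_nat n :
  fps_comp (fps_binom n%:R) fps_expm1 = fps_exp n%:R.
Proof.
have b0 : fps_binom 0 = fps_one.
  apply/funext => -[|k]; first by rewrite /fps_binom big_ord0 divr1.
  by rewrite /fps_binom big_ord_recl /= subrr !mul0r.
have e0 : fps_exp 0 = fps_one.
  apply/funext => -[|k]; first by rewrite /fps_exp expr0 divr1.
  by rewrite /fps_exp expr0n mul0r.
have b1 : fps_comp (fps_binom 1) fps_expm1 = fps_exp 1.
  apply/funext => -[|k].
    rewrite /fps_comp big_ord_recl big_ord0 /fps_binom big_ord0 /fps_exp /=.
    by rewrite divr1 mul1r addr0.
  rewrite /fps_comp 2!big_ord_recl big1 ?addr0; last first.
    by move=> i _; rewrite /fps_binom 2!big_ord_recl /= subrr mul0r mulr0 !mul0r.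
  rewrite /fps_binom big_ord0 big_ord_recl big_ord0 subr0 /= fps_mulC fps_mul1.
  rewrite /fps_one /= mulr0 add0r /fps_expm1.
  by rewrite [X in _ * X](_ : _ = fps_exp 1 k.+1 - 0)// subr0 !mulr1 !mul1r.
elim: n => [|n IHn]; first by rewrite b0 e0 fps_comp_one.
by rewrite -natr1 fps_binomS fps_compM ?fps_expm1_0// IHn b1 fps_expD addrC.
Qed.

(* Both sides are polynomials in the exponent that agree at every natural
   number. *)
Lemma comp_binom_polyE k :
  \sum_(j < k.+1) fps_pow fps_expm1 j k *: binom_poly j = k`!%:R^-1 *: 'X^k.
Proof.
apply/eqP; rewrite -subr_eq0; set p := _ - _; apply/eqP.
apply: (@roots_geq_poly_eq0 _ p [seq n%:R | n <- iota 0 (size p)]).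
- apply/allP => _ /mapP[n _ ->]; apply/rootP.
  rewrite hornerD hornerN horner_sum hornerZ hornerXn.
  have := congr1 (fun f => f k) (fps_comp_binom_nat n).
  rewrite /fps_comp /fps_exp mulrC => <-; apply/eqP; rewrite subr_eq0; apply/eqP.
  by apply: eq_bigr => j _; rewrite hornerZ horner_binom_poly mulrC.
- by rewrite map_inj_uniq ?iota_uniq//; exact: mulrIn.
- by rewrite size_map size_iota.
Qed.

Lemma fps_comp_binom a : fps_comp (fps_binom a) fps_expm1 = fps_exp a.
Proof.
apply/funext => k; have := congr1 (horner^~ a) (comp_binom_polyE k).
rewrite /= horner_sum hornerZ hornerXn mulrC -/(fps_exp a k) => <-.
by apply: eq_bigr => j _; rewrite hornerZ horner_binom_poly mulrC.
Qed.

(* The derivative at 0, in the exponent, of the previous identity. *)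
Lemma fps_comp_log1p :
  fps_comp fps_log1p fps_expm1 = (fun k => (k == 1%N)%:R).
Proof.
apply/funext => k; have := congr1 (fun p => p`_1) (comp_binom_polyE k).
rewrite /= coef_sum coefZ coefXn eq_sym => h.
transitivity (k`!%:R^-1 * (k == 1%N)%:R : rat).
  by rewrite -h; apply: eq_bigr => j _; rewrite coefZ coef1_binom_poly mulrC.
by case: eqP => [->|_]; rewrite ?mulr0// mulr1 invr1.
Qed.

End FormalPowerSeriesComposition.

(** * The functionals [phi_{a,s}] *)

Section UmbralFunctional.
Implicit Types (f g G : nat -> rat) (a x : rat) (P C : {poly rat}).

(** What [phi f] becomes once [z] is evaluated at a rational; see [horner_phi]. *)
Definition umbral f P : rat := \sum_(k < size P) f k * P`_k.

Lemma umbral_widen N f P : (size P <= N)%N ->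
  umbral f P = \sum_(k < N) f k * P`_k.
Proof.
move=> PN; rewrite /umbral (big_ord_widen N (fun k => f k * P`_k))//.
rewrite big_mkcond; apply: eq_bigr => i _; case: ltnP => // /(nth_default 0) ->.
by rewrite mulr0.
Qed.

Lemma umbral_is_scalar f : scalar (umbral f).
Proof.
move=> c P C; pose N := maxn (size (c *: P + C)) (maxn (size P) (size C)).
rewrite !(@umbral_widen N) ?leq_max ?leqnn ?orbT// mulr_sumr -big_split.
by apply: eq_bigr => i _; rewrite coefD coefZ mulrDr mulrCA.
Qed.

HB.instance Definition _ f :=
  GRing.isLinear.Build rat {poly rat} rat *%R (umbral f) (umbral_is_scalar f).

Lemma umbralXn f n : umbral f 'X^n = f n.
Proof.
rewrite /umbral size_polyXn big_ord_recr big1 /= => [|[i /= ik] _].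
  by rewrite add0r coefXn eqxx mulr1.
by rewrite coefXn lt_eqF ?mulr0.
Qed.

Lemma umbralBl f g P : umbral (f - g) P = umbral f P - umbral g P.
Proof.
rewrite /umbral -sumrB; apply: eq_bigr => i _.
by rewrite -mulrBl.
Qed.

Lemma scalar_polyP (f g : {scalar {poly rat}}) :
  (forall n, f 'X^n = g 'X^n) -> f =1 g.
Proof.
move=> fg P; rewrite -[P]coefK poly_def !linear_sum.
by apply: eq_bigr => i _; rewrite !linearZ fg.
Qed.

(** The part of [mellin_inv] that follows the substitution of [e^z - 1]. With [D = d/dt],
    [umbral (mellin G) P] is [- (G(-D) P)(0)]. *)
Definition mellin G : nat -> rat := fun k => (-1) ^+ k.+1 * (k`!%:R * G k).

Lemma mellinB f g : mellin (f - g) = mellin f - mellin g.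
Proof.
apply/funext => k; rewrite [RHS](_ : _ = mellin f k - mellin g k)//.
by rewrite /mellin -!mulrBr.
Qed.

(** The factor [e^{az}] acts as [exp(-aD)], which is translation by [-a] (Taylor). On [t^n] this is
    the binomial theorem. *)
Lemma umbral_mellin_shift a G P :
  umbral (mellin G) (P \Po ('X - a%:P)) =
  umbral (mellin (fps_mul (fps_exp a) G)) P.
Proof.
pose L := umbral (mellin G) \o comp_poly ('X - a%:P).
rewrite -[LHS]/(L P).
apply: (@scalar_polyP L) => n.
rewrite /= comp_Xn_poly umbralXn exprDn linear_sum /mellin /fps_mul !mulr_sumr.
apply: eq_bigr => -[i /= ik] _; rewrite ltnS in ik.
rewrite linearMn /= -polyCN -polyC_exp mulrC mul_polyC linearZ /= umbralXn.
rewrite /mellin /fps_exp -[LHS]mulr_natr [(- a) ^+ i]exprNn.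
have -> : (-1) ^+ n.+1 = (-1) ^+ i * (-1) ^+ (n - i).+1 :> rat.
  by rewrite -exprD addnS subnKC.
rewrite -(bin_fact ik) !natrM.
have f0 : i`!%:R != 0 :> rat by rewrite pnatr_eq0 -lt0n fact_gt0.
by field.
Qed.

Lemma umbral_mellin_delta n P :
  umbral (mellin (fun k => (k == n)%:R)) P = (-1) ^+ n.+1 * n`!%:R * P`_n.
Proof.
rewrite (@umbral_widen (maxn (size P) n.+1)) ?leq_maxl//.
rewrite (bigD1 (Ordinal (leq_maxr (size P) n.+1)))//= /mellin eqxx mulr1.
rewrite big1 ?addr0// => i; rewrite -val_eqE /= => /negPf ->.
by rewrite !mulr0 mul0r.
Qed.

(** The case [a = 1] of the translation rule, minus the identity: [e^z - 1] is dual to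
    [Delta_m1]. *)
Lemma umbral_mellin_Delta G P :
  umbral (mellin G) (Delta_m1 P) = umbral (mellin (fps_mul fps_expm1 G)) P.
Proof.
rewrite /Delta_m1 linearB /= -polyC1 umbral_mellin_shift.
by rewrite /fps_expm1 fps_mulBl fps_mul1 mellinB umbralBl.
Qed.

(** The factor [e^z - 1] produced by [Delta_m1] cancels the division by [z] in [Rformal] and leaves
    [e^{az} - 1], a difference of two evaluations. *)
Lemma umbral_Rformal1_Delta a P :
  umbral (Rformal a 1) (Delta_m1 P) = P.[0] - P.[- a].
Proof.
set g := fps_binom a - fps_one.
rewrite -[Rformal a 1]/(mellin (fps_comp (fps_divz g) fps_expm1)).
have g0 : g 0%N = 0.
  by rewrite (_ : g 0%N = fps_binom a 0 - 1)// /fps_binom big_ord0 divr1 subrr.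
rewrite umbral_mellin_Delta fps_mul_comp_divz ?fps_expm1_0//.
rewrite fps_compB fps_comp_binom fps_comp_one mellinB umbralBl.
rewrite -[fps_exp a]fps_mul1 fps_mulC -umbral_mellin_shift.
rewrite /fps_one !(umbral_mellin_delta 0) !mulr1 !mulN1r opprK.
by rewrite -!horner_coef0 horner_comp hornerD hornerN hornerX hornerC add0r addrC.
Qed.

(** After the same cancellation [e^{az} z^(s+1)] remains: up to sign, the derivative of order [s+1]
    at [-a]. The weight called [s] in [Rformal] is [s.+2] here. *)
Lemma umbral_Rformal_Delta a s P :
  umbral (Rformal a s.+2) (Delta_m1 P) =
  (-1) ^+ s.+2 * s.+1`!%:R * (P \Po ('X - a%:P))`_s.+1.
Proof.
set g := fps_mul (fps_binom a) (fps_pow fps_log1p s.+1).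
rewrite -[Rformal a _]/(mellin (fps_comp (fps_divz g) fps_expm1)).
have g0 : g 0%N = 0.
  by rewrite /g /fps_mul big_ord_recl big_ord0 addr0 fps_pow_ltn ?mulr0.
rewrite umbral_mellin_Delta fps_mul_comp_divz ?fps_expm1_0//.
rewrite fps_compM ?fps_expm1_0// fps_comp_binom fps_comp_pow ?fps_expm1_0//.
rewrite fps_comp_log1p fps_pow_X -umbral_mellin_shift.
exact: umbral_mellin_delta.
Qed.

Lemma horner_phi f x (S : {poly {poly rat}}) :
  (phi f S).[x] = umbral f (map_poly (horner_eval x) S).
Proof.
rewrite /phi horner_sum (@umbral_widen (size S)) ?size_poly//.
by apply: eq_bigr => i _; rewrite hornerZ coef_map.
Qed.

Lemma map_div_diffK x P :
  map_poly (horner_eval x) (div_diff P) * (x%:P - 'X) = P.[x]%:P - P.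
Proof.
have /(congr1 (map_poly (horner_eval x))) := div_diffK P.
rewrite rmorphM !rmorphB /= !map_polyC map_polyX /=.
have -> : map_poly (horner_eval x) P^:P = P.
  by rewrite -map_poly_comp map_poly_id// => c _; exact: hornerC.
by rewrite [horner_eval x 'X]hornerX => ->.
Qed.

End UmbralFunctional.

(** * The difference operator *)

Section DifferenceOperator.
Implicit Types (P q C : {poly rat}).

Lemma Delta_m1_is_linear : linear Delta_m1.
Proof.
move=> c P C; rewrite /Delta_m1 comp_polyD comp_polyZ scalerBr.
by rewrite opprD addrACA.
Qed.

HB.instance Definition _ :=
  GRing.isLinear.Build rat {poly rat} {poly rat} *:%R Delta_m1 Delta_m1_is_linear.

Lemma iter_Delta_m1_is_linear n : linear (iter n Delta_m1).
Proof. by elim: n => // n IHn c P C; rewrite !iterS IHn linearP. Qed.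

HB.instance Definition _ n :=
  GRing.isLinear.Build rat {poly rat} {poly rat} *:%R (iter n Delta_m1)
    (iter_Delta_m1_is_linear n).

Definition shift (c : rat) P : {poly rat} := P \Po ('X + c%:P).

Lemma shift_is_linear c : linear (shift c).
Proof. by move=> a P C; rewrite /shift comp_polyD comp_polyZ. Qed.

HB.instance Definition _ c :=
  GRing.isLinear.Build rat {poly rat} {poly rat} *:%R (shift c)
    (shift_is_linear c).

Lemma shiftM c P C : shift c (P * C) = shift c P * shift c C.
Proof. exact: comp_polyM. Qed.

Lemma shift0 P : shift 0 P = P.
Proof. by rewrite /shift addr0 comp_polyXr. Qed.

Lemma shift_shift a b P : shift b (shift a P) = shift (a + b) P.
Proof.
rewrite /shift -comp_polyA comp_polyD comp_polyX comp_polyC polyCD.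
by rewrite -addrA [_%:P + _%:P]addrC.
Qed.

Lemma shift_linear_factor c a : shift c ('X + a%:P) = 'X + (a + c)%:P.
Proof.
rewrite /shift comp_polyD comp_polyX comp_polyC polyCD -addrA.
by rewrite [_%:P + _%:P]addrC.
Qed.

Lemma Delta_m1E P : Delta_m1 P = shift (-1) P - P.
Proof. by rewrite /shift polyCN. Qed.

Lemma Delta_m1_shift P c : Delta_m1 (shift c P) = shift c (Delta_m1 P).
Proof. by rewrite !Delta_m1E linearB /= !shift_shift addrC [c + _]addrC addrC. Qed.

Lemma iter_Delta_m1_shift n P c :
  iter n Delta_m1 (shift c P) = shift c (iter n Delta_m1 P).
Proof. by elim: n => //= n ->; rewrite Delta_m1_shift. Qed.

(** Summation by parts, the source of both orthogonality statements below. *)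
Lemma mul_Delta_m1 q P :
  q * Delta_m1 P = Delta_m1 (q * P) - Delta_m1 q * shift (-1) P.
Proof. by rewrite !Delta_m1E shiftM; ring. Qed.

(** [(X - 1)^(k+1) - X^(k+1)] factors as [-1] times a sum of [k+1] monic polynomials of degree
    [k]. *)
Lemma coef_Delta_m1_Xn k j : (k <= j)%N ->
  (Delta_m1 'X^(k.+1))`_j = - (k.+1%:R *+ (j == k)).
Proof.
move=> kj; rewrite /Delta_m1 comp_Xn_poly subrXX -addrA [- 1 - _]addrC addrA.
rewrite subrr sub0r mulN1r coefN coef_sum; congr (- _).
have mon (i : 'I_k.+1) :
    (('X - 1) ^+ (k.+1.-1 - i) * 'X^i)%R \is @monic rat.
  by rewrite monicMl ?monicXn// monic_exp// -polyC1 monicXsubC.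
have sz (i : 'I_k.+1) : size (('X - 1) ^+ (k.+1.-1 - i) * 'X^i : {poly rat})%R = k.+1.
  rewrite -polyC1 size_monicM ?monic_neq0 ?monicXn ?monic_exp ?monicXsubC ?monicX//.
  rewrite size_exp_XsubC size_polyXn addnS addSn /= subnK//.
  by rewrite -ltnS.
have [->|jk] := eqVneq j k.
  rewrite (eq_bigr (fun=> 1)) ?sumr_const ?card_ord// => i _.
  by have /monicP := mon i; rewrite lead_coefE sz.
rewrite big1 // => i _; apply: nth_default.
by rewrite sz ltn_neqAle eq_sym jk.
Qed.

Lemma coef_Delta_m1 P j : ((size P).-1 <= j.+1)%N ->
  (Delta_m1 P)`_j = - (j.+1%:R * P`_j.+1).
Proof.
move=> szP; rewrite -{1}[P]coefK poly_def linear_sum coef_sum.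
have D1 : Delta_m1 1 = 0 by rewrite /Delta_m1 -polyC1 comp_polyC subrr.
have F0 (i : nat) : (i <= j.+1)%N -> i != j.+1 -> (Delta_m1 (P`_i *: 'X^i))`_j = 0.
  case: i => [|i] ij nij; first by rewrite linearZ /= D1 scaler0 coef0.
  rewrite linearZ /= coefZ coef_Delta_m1_Xn// gtn_eqF ?oppr0 ?mulr0//.
  by rewrite ltn_neqAle -ltnS ij andbT -eqSS.
have [sj|sj] := leqP (size P) j.+1.
  rewrite [P`_j.+1]nth_default// mulr0 oppr0 big1// => -[i /= iP] _.
  by apply: F0; [exact: ltnW (leq_trans iP sj) | rewrite ltn_eqF// (leq_trans iP)].
have sE : size P = j.+2.
  move: szP sj; case: (size P) => //= s s1 s2.
  by apply/eqP; rewrite eqn_leq s2 andbT ltnS.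
rewrite sE big_ord_recr /= big1 ?add0r => [|[i /= ij] _]; last first.
  by apply: F0; [exact: ltnW | rewrite ltn_eqF].
by rewrite linearZ /= coefZ coef_Delta_m1_Xn// eqxx mulrN mulrC.
Qed.

Lemma size_Delta_m1 P : size (Delta_m1 P) = (size P).-1.
Proof.
apply/eqP; rewrite eqn_leq; apply/andP; split.
  apply/leq_sizeP => j Pj; rewrite coef_Delta_m1; last exact: leqW.
  rewrite nth_default ?mulr0 ?oppr0//.
  by case: (size P) Pj.
case sP : (size P) => [|[|k]] //=; rewrite ltnNge; apply/negP => h.
have := nth_default 0 h; rewrite coef_Delta_m1 ?sP//.
move/eqP; rewrite oppr_eq0 mulf_eq0 pnatr_eq0 /=.
by rewrite -[k.+1]/(k.+2.-1) -sP lead_coef_eq0 -size_poly_eq0 sP.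
Qed.

Lemma size_iter_Delta_m1 n P : size (iter n Delta_m1 P) = (size P - n)%N.
Proof. by elim: n => [|n IHn] /=; rewrite ?subn0// size_Delta_m1 IHn subnS. Qed.

(** The leading term is removed by a multiple of [Delta_m1 'X^(n.+1)]. Constants lie in the kernel,
    which leaves room for the normalisation [C(0) = 0]. *)
Lemma Delta_m1_surj n P : (size P <= n)%N ->
  exists C, [/\ Delta_m1 C = P, C.[0] = 0 & (size C <= n.+1)%N].
Proof.
elim: n P => [|n IHn] P.
  rewrite leqn0 size_poly_eq0 => /eqP ->; exists 0.
  by rewrite linear0 horner0 size_poly0.
move=> sP; pose c := - P`_n / n.+1%:R.
have [|C [CE C0 sC]] := IHn (P - c *: Delta_m1 'X^(n.+1)).
  apply/leq_sizeP => j nj; rewrite coefB coefZ coef_Delta_m1_Xn//.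
  have [->|jn] := eqVneq j n.
    rewrite mulr1n /c; field; rewrite ?natr1 ?pnatr_eq0//.
  by rewrite oppr0 mulr0 subr0 nth_default// (leq_trans sP)// ltn_neqAle eq_sym jn.
exists (C + c *: 'X^(n.+1)); split.
- by rewrite linearD linearZ /= CE subrK.
- by rewrite !hornerE C0 expr0n mulr0 addr0.
- rewrite (leq_trans (size_polyD _ _))// geq_max (leq_trans sC)//=.
  by rewrite (leq_trans (size_scale_leq _ _))// size_polyXn.
Qed.

End DifferenceOperator.

(** * Nonvanishing of the determinant *)

(** Substituting [X - a] turns [X + a] into [X]. The right side is stated with the Taylor
    coefficients that occur in [umbral_Rformal_Delta]. *)
Lemma dvdp_exp_linearP (F : fieldType) (a : F) (k : nat) (C : {poly F}) :
  reflect (forall r, (r < k)%N -> (C \Po ('X - a%:P))`_r = 0)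
          (('X + a%:P) ^+ k %| C).
Proof.
apply: (iffP idP) => [/dvdpP[q ->] r rk|h].
  rewrite comp_polyM rmorphXn /= comp_polyD comp_polyX comp_polyC subrK.
  by rewrite coefMXn rk.
set D := C \Po _ in h.
have DE : D = drop_poly k D * 'X^k.
  rewrite -[LHS](poly_take_drop k) [take_poly k D](_ : _ = 0) ?add0r//.
  by apply/polyP => r; rewrite coef_take_poly coef0; case: ifP => // /h.
have -> : C = D \Po ('X + a%:P).
  rewrite /D -comp_polyA comp_polyB comp_polyX comp_polyC addrK.
  by rewrite comp_polyXr.
by rewrite DE comp_polyM comp_Xn_poly dvdp_mull.
Qed.

Lemma prod_dvdp (F : fieldType) (I : finType) (f : I -> {poly F}) (C : {poly F}) :
  (forall i j, i != j -> coprimep (f i) (f j)) -> (forall i, f i %| C) ->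
  \prod_i f i %| C.
Proof.
move=> cop dvd; rewrite -big_enum /=.
have : uniq (enum I) := enum_uniq I.
elim: (enum I) => [|i r IHr] /=; first by rewrite big_nil dvd1p.
case/andP => ir ur; rewrite big_cons Gauss_dvdp ?dvd ?IHr//.
rewrite big_seq; elim/big_ind: _ => [|p q cp cq|j jr].
- exact: coprimep1.
- by rewrite coprimepMr cp.
- by apply: cop; apply: contraNneq ir => ->.
Qed.

(** The family is triangular for the degree, so the coefficients vanish from the top down. *)
Lemma lin_comb_poly_eq0 (F : fieldType) (N : nat) (b : nat -> {poly F})
    (c : 'I_N -> F) :
  (forall l, size (b l) = l.+1) -> \sum_(l < N) c l *: b l = 0 ->
  forall l, c l = 0.
Proof.
move=> sb; have lb l : (b l)`_l != 0.
  have := lead_coef_eq0 (b l); rewrite lead_coefE sb /= => ->.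
  by rewrite -size_poly_eq0 sb.
elim: N c => [|N IHN] c; first by move=> _ [].
rewrite big_ord_recr /= => h.
have cN : c ord_max = 0.
  have /(congr1 (fun p : {poly F} => p`_N)) := h.
  rewrite coefD coef_sum big1 => [|l _].
    by rewrite add0r coefZ coef0 => /eqP; rewrite mulf_eq0 (negPf (lb N)) orbF => /eqP.
  by rewrite coefZ nth_default ?mulr0// sb /= ltn_ord.
move: h; rewrite cN scale0r addr0 => /IHN h l.
have [j ->|->] := unliftP ord_max l; last exact: cN.
by rewrite -(h j); congr c; apply: val_inj; exact: lift_max.
Qed.

Lemma size_rising (a : rat) n : size (rising ('X + a%:P) n) = n.+1.
Proof.
rewrite /rising (eq_bigr (fun j : 'I_n => 'X - (- (a + (j : nat)%:R))%:P)).
  by rewrite -big_enum /= size_prod_XsubC size_enum_ord.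
by move=> j _; rewrite polyCN opprK polyCD polyC_natr addrA.
Qed.

(** The matrix is square since [#|T| = N], so full column rank is full row rank. *)
Lemma free_columns_rows (F : fieldType) (T : finType) (N : nat)
    (W : T -> 'I_N -> F) :
  #|T| = N ->
  (forall b : 'I_N -> F, (forall t, \sum_l b l * W t l = 0) -> forall l, b l = 0) ->
  forall a : T -> F, (forall l, \sum_t a t * W t l = 0) -> forall t, a t = 0.
Proof.
move=> TN hb a ha; pose Z := \matrix_(i < #|T|, l < N) W (enum_val i) l.
have ZT : row_free Z^T.
  apply: inj_row_free => v vZ; apply/rowP => l; rewrite mxE.
  apply: (hb (fun l => v 0 l)) => t; 
  have /rowP/(_ (enum_rank t)) := vZ.
  rewrite !mxE => vt; rewrite -[RHS]vt.
  by apply: eq_bigr => l' _; rewrite !mxE enum_rankK.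
have Zfree : row_free Z by rewrite /row_free -mxrank_tr (eqP ZT) TN.
have : \row_i a (enum_val i) *m Z == 0.
  apply/eqP/rowP => l; rewrite !mxE -[RHS](ha l).
  rewrite [RHS](reindex _ (onW_bij _ (enum_val_bij _))) /=.
  by apply: eq_bigr => i _; rewrite !mxE.
rewrite mulmx_free_eq0// => /eqP/rowP h t.
by have := h (enum_rank t); rewrite !mxE enum_rankK.
Qed.

Lemma big_option (V : nmodType) (T : finType) (F : option T -> V) :
  \sum_o F o = F None + \sum_t F (Some t).
Proof.
rewrite (bigD1 None)//=; congr (_ + _).
rewrite (reindex_omap Some id) => [|[//|//]].
by apply: eq_bigl => t; rewrite eqxx.
Qed.

(** * Orthogonality relations and the vanishing orders they encode *)

Section Nonvanishing.
Variables (d : nat) (m : 'I_d -> nat) (alpha : 'I_d -> rat) (hd : (0 < d)%N).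
Hypothesis halpha1 : alpha (Ordinal hd) = 0.
Hypothesis halpha :
  forall i j : 'I_d, i != j -> alpha i - alpha j \isn't a Num.int.
Implicit Types (P q A C S : {poly rat}) (u : index_set m).

Definition phi_u u : {scalar {poly rat}} :=
  umbral (Rformal (alpha (idx_i u)) (idx_s u)).

Definition vanishing C := forall i, ('X + (alpha i)%:P) ^+ (m i).+1 %| C.

(** Zeros of order at least [m_i + 1] at every [-alpha_i - j] with [j < n], as the rising factorials
    in [Apoly] provide. *)
Definition vanishing_shifts n C :=
  forall j, (j < n)%N -> vanishing (shift (- j%:R) C).

Lemma index_set_ex i r : (r < (m i).+1)%N ->
  ~~ ((i == 0 :> nat) && (r == 0))%N ->
  exists u : index_set m, idx_i u = i /\ idx_s u = r.+1.
Proof.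
move=> rm ir; pose v := Tagged (fun i => 'I_(m i).+1) (Ordinal rm).
by exists (exist (fun w : {i : 'I_d & 'I_(m i).+1} =>
  ~~ ((tag w == 0%N :> nat) && (tagged w == 0%N :> nat)))
  v ir : index_set m).
Qed.

Lemma vanishingB P C : vanishing P -> vanishing C -> vanishing (P - C).
Proof. by move=> vP vC i; rewrite dvdp_sub. Qed.

Lemma vanishingMr q C : vanishing C -> vanishing (q * C).
Proof. by move=> vC i; rewrite dvdp_mull. Qed.

Lemma vanishing0 C : vanishing C -> C.[0] = 0.
Proof.
move=> /(_ (Ordinal hd)); rewrite halpha1 addr0 => /dvdpP[q ->].
by rewrite hornerM hornerXn expr0n mulr0.
Qed.

(** For [s = 1] both [C(0)] and [C(-alpha_i)] vanish, the former because [alpha_1 = 0]; for [s >= 2]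
    the derivative of order [s - 1 <= m_i] at [-alpha_i] vanishes. *)
Lemma phi_u_Delta_m1 u C : vanishing C -> phi_u u (Delta_m1 C) = 0.
Proof.
move=> vC; have /dvdp_exp_linearP := vC (idx_i u).
rewrite /phi_u /= /idx_s; case: (tagged (val u)) => -[|r] rm /= cC.
  rewrite umbral_Rformal1_Delta vanishing0// sub0r.
  have /dvdpP[q ->] := vC (idx_i u).
  by rewrite hornerM horner_exp !hornerE addNr expr0n mulr0 oppr0.
by rewrite umbral_Rformal_Delta cC ?mulr0.
Qed.

Lemma vanishing_of_phi_u C : C.[0] = 0 ->
  (forall u, phi_u u (Delta_m1 C) = 0) -> vanishing C.
Proof.
move=> C0 h i; apply/dvdp_exp_linearP => -[|r] rm.
  rewrite -horner_coef0 horner_comp hornerD hornerN hornerX hornerC add0r.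
  (* The pair [(1,1)] is not an index; the condition it would give is [C(0) = 0], which is
     assumed. *)
  have [i0|i0] := eqVneq (nat_of_ord i) 0%N.
    by rewrite (_ : i = Ordinal hd) ?halpha1 ?oppr0//; exact: val_inj.
  have [|u [ui us]] := @index_set_ex i 0%N rm; first by rewrite negb_and i0.
  have := h u; rewrite /phi_u /= ui us umbral_Rformal1_Delta C0 sub0r.
  by move/eqP; rewrite oppr_eq0 => /eqP.
have [|u [ui us]] := @index_set_ex i r.+1 rm; first by rewrite negb_and orbT.
have := h u; rewrite /phi_u /= ui us umbral_Rformal_Delta.
move/eqP; rewrite mulf_eq0 => /orP[|/eqP//].
by rewrite mulf_eq0 signr_eq0 pnatr_eq0 eqn0Ngt fact_gt0.
Qed.

Lemma vanishing_shifts_Delta_m1 n C :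
  vanishing_shifts n.+1 C -> vanishing_shifts n (Delta_m1 C).
Proof.
move=> vC j jn; rewrite Delta_m1E linearB /= shift_shift -opprD nat1r.
by apply: vanishingB; apply: vC => //; exact: ltnW.
Qed.

Lemma vanishing_shifts_iter n C :
  vanishing_shifts n.+1 C -> vanishing (iter n Delta_m1 C).
Proof.
elim: n C => [|n IHn] C vC; first by have := vC 0%N isT; rewrite oppr0 shift0.
by rewrite iterSr; apply: IHn; exact: vanishing_shifts_Delta_m1.
Qed.

Lemma vanishing_shifts_shift n C :
  vanishing_shifts n.+1 C -> vanishing_shifts n (shift (-1) C).
Proof. by move=> vC j jn; rewrite shift_shift -opprD nat1r; exact: vC. Qed.

(** Induction on [n] by summation by parts: the full difference is killed by [phi_u_Delta_m1], and
    the other term has [Delta_m1 q], of smaller degree, in place of [q]. *)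
Lemma phi_u_orthogonal n u A q : vanishing_shifts n A -> (size q <= n)%N ->
  phi_u u (q * iter n Delta_m1 A) = 0.
Proof.
elim: n A q => [|n IHn] A q vA sq.
  by move: sq; rewrite leqn0 size_poly_eq0 => /eqP ->; rewrite mul0r linear0.
rewrite iterS mul_Delta_m1 linearB /= phi_u_Delta_m1; last first.
  exact/vanishingMr/vanishing_shifts_iter.
rewrite -iter_Delta_m1_shift IHn ?subrr//; first exact: vanishing_shifts_shift.
by rewrite size_Delta_m1; case: (size q) sq.
Qed.

(** Up to sign, the [n]-th difference of [C] is [C] plus a combination of the translates [C(z - j)],
    [1 <= j <= n]; the induction rests on [C = C(z - 1) - Delta_m1 C]. *)
Lemma vanishing_of_iter n C :
  (forall j, (0 < j <= n)%N -> vanishing (shift (- j%:R) C)) ->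
  vanishing (iter n Delta_m1 C) -> vanishing C.
Proof.
elim: n C => // n IHn C vC; rewrite iterSr => /IHn vD.
have -> : C = shift (-1) C - Delta_m1 C by rewrite Delta_m1E subKr.
apply: vanishingB; first exact: (vC 1%N).
apply: vD => j /andP[j0 jn]; rewrite Delta_m1E linearB /= shift_shift -opprD nat1r.
by apply: vanishingB; apply: vC; rewrite ?j0 ?ltnS ?jn// ltnW.
Qed.

(** Write [S = Delta_m1 C0]. Testing against [q = 1] makes [C0] vanishing; testing against higher
    degrees passes the hypothesis, one degree lower, to [C0(z - 1)]. *)
Lemma phi_u_orthogonal_converse n S :
  (forall u q, (size q <= n.+1)%N -> phi_u u (q * S) = 0) ->
  exists2 C, S = iter n.+1 Delta_m1 C & vanishing_shifts n.+1 C.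
Proof.
elim: n S => [|n IHn] S hS; have [C0 [CE C00 _]] := Delta_m1_surj (leqnn (size S)).
all: have vC0 : vanishing C0.
- apply: vanishing_of_phi_u => // u.
  by rewrite CE -[S]mul1r hS// size_poly1.
- by exists C0 => // -[|//] _; rewrite oppr0 shift0.
- apply: vanishing_of_phi_u => // u.
  by rewrite CE -[S]mul1r hS// size_poly1.
(* A test polynomial of size at most [n.+1] is [Delta_m1 r] with [r] of size at most [n.+2], a size
   still covered by [hS]. *)
have [|C1 C1E vC1] := IHn (shift (-1) C0).
  move=> u q sq; have [r [<- _ sr]] := Delta_m1_surj sq.
  have -> : Delta_m1 r * shift (-1) C0 = Delta_m1 (r * C0) - r * S.
    by rewrite -CE mul_Delta_m1 subKr.
  by rewrite linearB /= phi_u_Delta_m1 ?hS ?subrr//; exact: vanishingMr.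
have C0E : C0 = iter n.+1 Delta_m1 (shift 1 C1).
  by rewrite iter_Delta_m1_shift -C1E shift_shift addNr shift0.
have vS j : (0 < j <= n.+1)%N -> vanishing (shift (- j%:R) (shift 1 C1)).
  case: j => // j /= jn; rewrite shift_shift -natr1 opprD addrCA subrr addr0.
  exact: vC1.
exists (shift 1 C1); first by rewrite iterS -C0E.
move=> [_|j jn]; last by apply: vS; rewrite ltnS.
(* The shift [j = 0] is not given by [vC1]; it comes from [C0], the [n.+1]-st difference of
   [shift 1 C1]. *)
rewrite oppr0 shift0; apply: (@vanishing_of_iter n.+1) => //.
by rewrite -C0E.
Qed.

(** * Counting zeros against the degree *)

Let K := (\sum_i (m i).+1)%N.

(** The points [-alpha_i - j] are distinct because no [alpha_i - alpha_i'] with distinct [i], [i']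
    is an integer, so a nonzero [C] has degree at least [n * K]. *)
Lemma vanishing_shifts_eq0 n C : vanishing_shifts n C -> (size C <= n * K)%N ->
  C = 0.
Proof.
move=> vC sC; apply: contraTeq sC => C0; rewrite -ltnNge.
pose f (ij : 'I_d * 'I_n) : {poly rat} :=
  ('X + (alpha ij.1 + (ij.2 : nat)%:R)%:P) ^+ (m ij.1).+1.
have fE ij : f ij = ('X - (- (alpha ij.1 + (ij.2 : nat)%:R))%:P) ^+ (m ij.1).+1.
  by rewrite polyCN opprK.
have : \prod_ij f ij %| C.
  apply: prod_dvdp => [[i j] [i' j'] ne|[i j]].
    rewrite !fE coprimep_expl ?coprimep_expr// coprimep_XsubC root_XsubC.
    apply: contra ne; rewrite eqr_opp /= => /eqP e.
    have [ii|ii] := eqVneq i i'.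
      rewrite -ii in e *; move/addrI/eqP: e; rewrite eqr_nat => jj.
      by rewrite xpair_eqE eqxx -val_eqE /= eq_sym.
    have /negP[] := halpha ii.
    rewrite (_ : _ - _ = (j' : nat)%:R - (j : nat)%:R); last by move: e; lra.
    by rewrite rpredB ?Num.Theory.natr_int.
  have /dvdp_exp_linearP hC := vC j (ltn_ord j) i.
  rewrite /f /=; apply/dvdp_exp_linearP => r rm; rewrite -[RHS](hC r rm).
  congr (_`_r); rewrite /shift -comp_polyA; congr (_ \Po _).
  rewrite comp_polyD comp_polyX comp_polyC !polyCD polyCN opprD.
  by rewrite addrA.
move=> /(dvdp_leq C0); apply: leq_trans.
have f0 ij : f ij != 0 by rewrite fE expf_neq0// polyXsubC_eq0.
rewrite size_prod//; rewrite (eq_bigr (fun ij => (m ij.1).+2)); last first.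
  by move=> ij _; rewrite fE size_exp_XsubC.
rewrite -(pair_bigA _ (fun i (j : 'I_n) => (m i).+2)) /=.
under eq_bigr do rewrite sum_nat_const card_ord -addn1 mulnDr muln1.
rewrite big_split /= -big_distrr /= -/K sum_nat_const card_ord.
rewrite card_prod !card_ord; lia.
Qed.

(** With [S] the [n.+1]-st difference of [C], the degree drops by [n+1]: the bound [(n+1)(K-1)] on
    [S] becomes [(n+1)K] on [C]. *)
Lemma phi_u_null_eq0 n S : (size S <= n.+1 * K.-1)%N ->
  (forall u q, (size q <= n.+1)%N -> phi_u u (q * S) = 0) -> S = 0.
Proof.
move=> sS /phi_u_orthogonal_converse[C SE vC].
have K0 : (0 < K)%N by rewrite /K (bigD1 (Ordinal hd)).
rewrite SE (@vanishing_shifts_eq0 n.+1 C) ?linear0//.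
by move: sS; rewrite SE size_iter_Delta_m1 -{2}(prednK K0); lia.
Qed.

(** * The polynomials [Apoly] and the matrix of values at [x] *)

Let common_factor n : {poly rat} :=
  \prod_(i < d) (((-1) ^+ n / n`!%:R) *: rising ('X + (alpha i)%:P) n)
                  ^+ (m i).+1.

(** The only factor of [Apoly] that depends on [l]; its degree is exactly [l], whence the
    independence of the columns. *)
Let low_factor l : {poly rat} := ((-1) ^+ l / l`!%:R) *: rising 'X l.

Let sign_fact_neq0 n : (-1) ^+ n / n`!%:R != 0 :> rat.
Proof. by rewrite mulf_neq0 ?signr_eq0// invr_eq0 pnatr_eq0 -lt0n fact_gt0. Qed.

Lemma size_low_factor l : size (low_factor l) = l.+1.
Proof. by rewrite size_scale// -['X]addr0 size_rising. Qed.

Lemma size_common_factor n : size (common_factor n) = (n * K).+1.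
Proof.
have s i : size (((-1) ^+ n / n`!%:R) *: rising ('X + (alpha i)%:P) n) = n.+1.
  by rewrite size_scale// size_rising.
have f0 i : ((-1) ^+ n / n`!%:R) *: rising ('X + (alpha i)%:P) n != 0.
  by rewrite -size_poly_eq0 s.
have := @size_prod _ _ predT _ (fun i _ => expf_neq0 (m i).+1 (f0 i)).
rewrite -/(common_factor n) => ->.
rewrite (eq_bigr (fun i => n * (m i).+1 + 1)%N).
  by rewrite big_split /= -big_distrr /= sum_nat_const muln1; exact: (addnK _ (n * K).+1).
move=> i _.
have := size_exp (((-1) ^+ n / n`!%:R) *: rising ('X + (alpha i)%:P) n) (m i).+1.
rewrite s /= => <-; rewrite addn1 prednK// lt0n size_poly_eq0.
exact: expf_neq0.
Qed.

(** The factor [X + alpha_i + j] of the rising factorial becomes [X + alpha_i] under the shift by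
    [-j]. *)
Lemma vanishing_shifts_common_factor q n :
  vanishing_shifts n (q * common_factor n).
Proof.
move=> j jn i; rewrite shiftM dvdp_mull//.
have -> : common_factor n =
    (\prod_(i' < d | i' != i)
      (((-1) ^+ n / n`!%:R) *: rising ('X + (alpha i')%:P) n) ^+ (m i').+1) *
    (((-1) ^+ n / n`!%:R) *: rising ('X + (alpha i)%:P) n) ^+ (m i).+1.
  by rewrite /common_factor (bigD1 i)//= mulrC.
rewrite shiftM dvdp_mull// /shift rmorphXn /= dvdp_exp2r//.
rewrite -/(shift _ _) linearZ /= dvdpZr// /rising (bigD1 (Ordinal jn))//= shiftM.
rewrite -polyC_natr -addrA -polyCD shift_linear_factor addrK.
exact: dvdp_mulr.
Qed.

Lemma PQ_columns_independent n x (c : 'I_K -> rat) :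
  \sum_l c l * (Ppoly m alpha n l).[x] = 0 ->
  (forall u, \sum_l c l * (Qpoly m alpha n (idx_i u) (idx_s u) l).[x] = 0) ->
  forall l, c l = 0.
Proof.
move=> hP hQ; pose B := \sum_l c l *: low_factor l.
suff B0 : B = 0.
  by apply: lin_comb_poly_eq0 B0; exact: size_low_factor.
pose A := B * common_factor n; pose P := iter n Delta_m1 A.
have PE : P = \sum_l c l *: Ppoly m alpha n l.
  rewrite /P /A /B mulr_suml linear_sum; apply: eq_bigr => l _ /=.
  by rewrite -scalerAl linearZ.
have K0 : (0 < K)%N by rewrite /K (bigD1 (Ordinal hd)).
have sB : (size B <= K)%N.
  apply: leq_trans (size_sum _ _ _) _; apply/bigmax_leqP => l _.
  by rewrite (leq_trans (size_scale_leq _ _))// size_low_factor.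
(* [S] is the divided difference of [P] at [x]; since [P(x) = 0] it is [P / (X - x)]. *)
pose S := \sum_l c l *: map_poly (horner_eval x) (div_diff (Ppoly m alpha n l)).
have SP : S * ('X - x%:P) = P.
  rewrite -opprB mulrN /S mulr_suml.
  under eq_bigr do rewrite -scalerAl map_div_diffK scalerBr.
  rewrite sumrB opprB -PE (_ : \sum_i _ = 0) ?subr0//.
  under eq_bigr do rewrite -mul_polyC -polyCM.
  by rewrite -(rmorph_sum polyC) /= hP.
have phiS u : phi_u u S = 0.
  rewrite /S linear_sum -[RHS](hQ u); apply: eq_bigr => l _.
  by rewrite linearZ /= /Qpoly horner_phi.
have S0 : S = 0.
  (* Degree count: [A] has size at most [(n+1)K], the [n] differences remove [n], and the division
     by [X - x] removes one more. *)
  apply: (@phi_u_null_eq0 n) => [|u q sq].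
    have [->|S0] := eqVneq S 0; first by rewrite size_poly0.
    have : size P = (size S).+1.
      by rewrite -SP size_Mmonic ?monicXsubC// size_XsubC addn2.
    have : (size A <= (size B + size (common_factor n)).-1)%N.
      exact: size_polyMleq.
    rewrite size_iter_Delta_m1 size_common_factor.
    case: K K0 sB => // k _ sB; rewrite /= !mulnS !mulSn.
    by move: (size A) (size B) (size S) sB; lia.
  (* Writing [q = q(x) + r (X - x)] gives [q S = q(x) S + r P]: [phiS] kills the first term,
     orthogonality the second. *)
  have [r rE] : exists r, q - q.[x]%:P = r * ('X - x%:P).
    by apply/factor_theorem; rewrite rootE !hornerE subrr.
  have sr : (size r <= n)%N.
    have [->|r0] := eqVneq r 0; first by rewrite size_poly0.
    have : (size (r * ('X - x%:P))%R <= n.+1)%N.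
      rewrite -rE (leq_trans (size_polyD _ _))// geq_max sq size_polyN.
      by rewrite (leq_trans (size_polyC_leq1 _)).
    by rewrite size_Mmonic ?monicXsubC// size_XsubC addn2.
  rewrite -[q](subrK q.[x]%:P) rE mulrDl linearD /= -mulrA [_ * S]mulrC SP.
  rewrite mul_polyC linearZ /= phiS mulr0 addr0.
  by apply: phi_u_orthogonal => //; exact: vanishing_shifts_common_factor.
(* If [B] were nonzero, [A] would have size at least [n * K + 1 > n], and [n] differences could not
   annihilate it. *)
apply/eqP/contraT => B0; have : size P = 0%N by rewrite -SP S0 mul0r size_poly0.
rewrite /P size_iter_Delta_m1 /A size_mul// -?size_poly_eq0 size_common_factor//.
have := leq_pmulr n K0; move: B0; rewrite -size_poly_gt0.
by move: (size B); lia.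
Qed.

(** [None] takes the place of the removed pair [(1,1)]. *)
Lemma card_option_index_set : #|{: option (index_set m)}| = K.
Proof.
rewrite card_option card_sig.
pose w0 : {i : 'I_d & 'I_(m i).+1} :=
  Tagged (fun i => 'I_(m i).+1) (@ord0 (m (Ordinal hd))).
rewrite (eq_card (B := predC1 w0)); last first.
  move=> w; rewrite !inE; congr (~~ _); apply/andP/eqP => [[]|->//].
  case: w => i r /= /eqP i0 /eqP r0.
  have {}i0 : i = Ordinal hd by exact: val_inj.
  rewrite i0 in r r0 *; congr existT; exact: val_inj.
rewrite cardC1 card_tagged sumnE big_map big_enum /= prednK.
  by apply: eq_bigr => i _; rewrite card_ord.
by rewrite (bigD1 (Ordinal hd))//= card_ord.
Qed.

Lemma card_columns : (Mtot m).+1 = K.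
Proof.
rewrite /Mtot -addn1 subnK; last by rewrite (leq_trans hd)// leq_addl.
rewrite /K [RHS](eq_bigr (fun i => m i + 1)%N) => [|i _]; last by rewrite addn1.
by rewrite big_split /= sum_nat_const card_ord muln1.
Qed.

Lemma PQ_rows_independent n x (c : option (index_set m) -> rat) :
  (forall l, (l <= Mtot m)%N ->
    c None * (Ppoly m alpha n l).[x] +
    \sum_u c (Some u) * (Qpoly m alpha n (idx_i u) (idx_s u) l).[x] = 0) ->
  forall o, c o = 0.
Proof.
move=> hc.
pose W (o : option (index_set m)) (l : 'I_K) : rat :=
  if o is Some u then (Qpoly m alpha n (idx_i u) (idx_s u) l).[x]
  else (Ppoly m alpha n l).[x].
apply: (@free_columns_rows _ _ _ W) => [|b hb|l].
- exact: card_option_index_set.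
- apply: (@PQ_columns_independent n x) => [|u].
    exact: (hb None).
  exact: (hb (Some u)).
rewrite big_option /= hc// -ltnS card_columns; exact: ltn_ord.
Qed.

End Nonvanishing.

(** * Archimedean and p-adic estimates *)

Section Asymptotics.
Local Open Scope classical_set_scope.
Variable R : realType.
Implicit Types (a : nat -> rat) (b e C : R).

(** The slack [e] makes the inequality on the limsup strict, so it holds for a tail of the sequence,
    where [n]-th powers are taken. *)
Lemma limsup_root_bound a b e : (forall n, 0 <= a n) -> 0 < e ->
  (limsup_root R a <= (expR b)%:E)%E ->
  \forall n \near \oo, ratr (a n) <= expR ((b + e) * n%:R).
Proof.
move=> a0 e0 hb.
have : (limsup_root R a < (expR (b + e))%:E)%E.
  by apply: le_lt_trans hb _; rewrite lte_fin ltr_expR ltrDl.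
move=> /ereal_inf_lt[_ [V [N _ NV] <-]] hV.
(* Index 0 is excluded: its exponent is 0 and the root carries no information there. *)
exists N.+1 => // n /= Nn.
have : ((ratr (a n) `^ n%:R^-1)%:E <= (expR (b + e))%:E :> \bar R)%E.
  apply: le_trans (ltW hV); apply: ereal_sup_ubound; exists n => //.
  by apply: NV => /=; exact: ltnW.
rewrite lee_fin => h.
have n0 : n%:R != 0 :> R by rewrite pnatr_eq0; case: n Nn {h}.
have ra0 : 0 <= ratr (a n) :> R by rewrite ler0q.
rewrite expRM -[leLHS](powRr1 ra0) -[X in _ `^ X <= _](mulVf n0) powRrM.
by apply: ge0_ler_powR; rewrite ?nnegrE ?powR_ge0 ?expR_ge0.
Qed.

Lemma expR_decay C e : 0 < e ->
  \forall n \near \oo, C * expR (- (e * n%:R)) < 1.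
Proof.
move=> e0; near=> n.
rewrite expRN ltr_pdivrMr ?expR_gt0// mul1r.
apply: lt_le_trans (expR_ge1Dx _); rewrite ltr_pwDl//.
rewrite mulrC -ler_pdivrMr//; near: n; exact: nbhs_infty_ger.
Unshelve. all: by end_near. Qed.

End Asymptotics.

(** * Integers and sums under the [p]-adic absolute value *)

Section PadicBounds.
Variable p : nat.

(** The power of [p] that divides [z] is the inverse of [padic_abs p z] and is at most [|z|]. *)
Lemma padic_abs_int_ge1 (z : rat) : prime p -> z \is a Num.int -> z != 0 ->
  1 <= `|z| * padic_abs p z.
Proof.
move=> pp /intrP[k ->]; rewrite intr_eq0 => k0.
rewrite /padic_abs intr_eq0 (negPf k0) /padic_val numq_int denq_int.
rewrite absz1 logn1 subr0 -invr_expz.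
have p0 : 0 < p%:R ^ (logn p `|k|%N)%:Z :> rat.
  by rewrite exprz_gt0// ltr0n prime_gt0.
rewrite ler_pdivlMr// mul1r -exprnP -natrX -intr_norm -abszE ler_nat.
by rewrite dvdn_leq ?absz_gt0// pfactor_dvdnn.
Qed.

(** Weaker than the ultrametric bound, but the lost constant is absorbed by the exponential
    decay. *)
Lemma Qp_abs_sum (I : finType) (f : I -> Qp p) :
  Qp_abs (\sum_i f i) <= \sum_i Qp_abs (f i).
Proof.
elim/big_ind2: _ => [|x a y b xa yb|//]; first by rewrite Qp_abs0.
apply: le_trans (Qp_absD _ _) (le_trans _ (lerD xa yb)).
by rewrite ge_max lerDl lerDr !Qp_abs_ge0.
Qed.

End PadicBounds.

Lemma common_denominator (I : finType) (c : I -> rat) :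
  exists2 L : nat, (0 < L)%N & forall i, L%:R * c i \is a Num.int.
Proof.
exists (\prod_i `|denq (c i)|)%N => [|i].
  by apply/prodn_gt0 => i; rewrite absz_gt0 denq_neq0.
rewrite (bigD1 i)//= natrM mulrAC mulrC rpredM ?natr_int//.
by rewrite pmulrn abszE normr_denq mulrC -numqE intr_int.
Qed.

(** * Linear forms that are small at both places *)

Section Vanishing.
Local Open Scope classical_set_scope.
Variables (R : realType) (p : nat) (I J : finType) (u0 : I) (c : option I -> rat).
Variables (D : nat -> nat) (P : nat -> J -> rat) (Q : nat -> I -> J -> rat).
Variables (r : nat -> I -> J -> Qp p) (beta rho_oo rho_p delta : R).
Hypothesis pp : prime p.
Hypothesis hDP : forall n l, (D n)%:R * P n l \is a Num.int.
Hypothesis hDQ : forall n u l, (D n)%:R * Q n u l \is a Num.int.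
Hypothesis D_gt0 : forall n, (0 < D n)%N.
Hypothesis hbeta : forall u l,
  (limsup_root R (fun n => Num.max `|P n l| `|Q n u l|)%R <= (expR beta)%:E)%E.
Hypothesis hrho_oo :
  (limsup_root R (fun n => (D n)%:R%R) <= (expR rho_oo)%:E)%E.
Hypothesis hrho_p :
  (limsup_root R (fun n => padic_abs p (D n)%:R%R) <= (expR (- rho_p))%:E)%E.
Hypothesis hdelta : forall u l,
  (limsup_root R (fun n => Qp_abs (r n u l)) <= (expR (- delta))%:E)%E.
Hypothesis hlt : beta + rho_oo < delta + rho_p.

Let form n l : rat := c None * P n l + \sum_u c (Some u) * Q n u l.

Hypothesis form_remainder : forall n l,
  Qp_of_rat p (form n l) = - \sum_u Qp_of_rat p (c (Some u)) * r n u l.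

Lemma form_abs_bound n l (B : R) : (ratr `|P n l| : R) <= B ->
  (forall u, (ratr `|Q n u l| : R) <= B) ->
  ratr `|form n l| <= ratr (\sum_o `|c o|) * B.
Proof.
move=> hP hQ.
have : `|form n l| <= `|c None| * `|P n l| + \sum_u `|c (Some u)| * `|Q n u l|.
  rewrite -normrM; apply: le_trans (ler_normD _ _) _; rewrite lerD2l.
  apply: le_trans (ler_norm_sum _ _ _) _.
  by apply: ler_sum => u _; rewrite normrM.
rewrite -(ler_rat R) => /le_trans; apply.
rewrite big_option !rmorphD /= mulrDl lerD//.
  by rewrite rmorphM ler_wpM2l// ler0q.
rewrite !rmorph_sum mulr_suml; apply: ler_sum => u _.
by rewrite rmorphM /= ler_wpM2l// ler0q.
Qed.

Lemma form_padic_bound n l (B : R) : (forall u, (ratr (Qp_abs (r n u l)) : R) <= B) ->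
  ratr (padic_abs p (form n l)) <= ratr (\sum_u padic_abs p (c (Some u))) * B.
Proof.
move=> hr; rewrite -Qp_abs_of_rat form_remainder Qp_absN.
have := Qp_abs_sum (fun u => Qp_of_rat p (c (Some u)) * r n u l).
rewrite -(ler_rat R) => /le_trans; apply.
rewrite !rmorph_sum mulr_suml; apply: ler_sum => u _.
by rewrite Qp_absM Qp_abs_of_rat rmorphM /= ler_wpM2l// ler0q padic_abs_ge0.
Qed.

(* Once cleared of denominators, a nonzero value [N] of the form would satisfy
   both [|N| * |N|_p >= 1] and [|N| * |N|_p < 1]. *)
Lemma form_eventually_zero : exists n, forall l, form n l = 0.
Proof.
have [L L0 Lc] := common_denominator c.
pose C1 : rat := L%:R * \sum_o `|c o|.
pose C2 : rat := padic_abs p L%:R * \sum_u padic_abs p (c (Some u)).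
(* Each of the four estimates costs [e]; with a gap of [5 e] a decay of [exp(- e n)] remains. *)
pose e := (delta + rho_p - beta - rho_oo) / 5%:R.
have e0 : 0 < e by rewrite /e divr_gt0//; move: hlt; lra.
have hM : \forall n \near \oo, forall l u,
    (ratr (Num.max `|P n l| `|Q n u l|) : R) <= expR ((beta + e) * n%:R).
  apply: filter_forall => l; apply: filter_forall => u.
  by apply: limsup_root_bound => // n; rewrite le_max normr_ge0.
have hr : \forall n \near \oo, forall l u,
    (ratr (Qp_abs (r n u l)) : R) <= expR ((- delta + e) * n%:R).
  apply: filter_forall => l; apply: filter_forall => u.
  by apply: limsup_root_bound => // n; exact: Qp_abs_ge0.
have hD1 : \forall n \near \oo, (ratr (D n)%:R : R) <= expR ((rho_oo + e) * n%:R).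
  exact: limsup_root_bound.
have hD2 : \forall n \near \oo,
    (ratr (padic_abs p (D n)%:R) : R) <= expR ((- rho_p + e) * n%:R).
  by apply: limsup_root_bound => // n; exact: padic_abs_ge0.
have hC := expR_decay (ratr (C1 * C2)) e0.
apply: (@filter_ex _ (nbhs \oo)).
near=> n => l; apply/eqP/contraT => a0.
pose N := L%:R * (D n)%:R * form n l.
have Nint : N \is a Num.int.
  rewrite /N /form mulrDr mulr_sumr rpredD ?rpred_sum// => [|u _].
    by rewrite mulrACA rpredM.
  by rewrite mulrACA rpredM.
have N0 : N != 0.
  by rewrite !mulf_neq0// pnatr_eq0 -lt0n.
have := padic_abs_int_ge1 pp Nint N0; rewrite -(ler_rat R) rmorph1 rmorphM /=.
suff : ratr `|N| * ratr (padic_abs p N) < 1 :> R by move=> /lt_geF ->.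
have Mn l' u : (ratr (Num.max `|P n l'| `|Q n u l'|) : R) <= expR ((beta + e) * n%:R).
  by move: l' u; near: n.
have rn u : (ratr (Qp_abs (r n u l)) : R) <= expR ((- delta + e) * n%:R).
  by move: l u {a0 N Nint N0}; near: n.
have D1 : (ratr (D n)%:R : R) <= expR ((rho_oo + e) * n%:R) by near: n.
have D2 : (ratr (padic_abs p (D n)%:R) : R) <= expR ((- rho_p + e) * n%:R).
  by near: n.
have B1 : ratr `|N| <= ratr C1 * (expR ((rho_oo + e) * n%:R) * expR ((beta + e) * n%:R)).
  rewrite /N /C1 !normrM !normr_nat !rmorphM /=.
  rewrite -![ratr L%:R * _ * _]mulrA ler_wpM2l ?ler0q//.
  rewrite [leRHS]mulrCA ler_pM ?ler0q//; apply: form_abs_bound => [|u].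
    (* The bound on [P] is only available inside a maximum with some [Q], hence the element [u0] of
       [I]. *)
    by apply: le_trans (Mn l u0); rewrite ler_rat le_max lexx.
  by apply: le_trans (Mn l u); rewrite ler_rat le_max lexx orbT.
have B2 : ratr (padic_abs p N) <=
    ratr C2 * (expR ((- rho_p + e) * n%:R) * expR ((- delta + e) * n%:R)).
  rewrite /N /C2 !padic_absM !rmorphM /=.
  rewrite -![ratr (padic_abs p L%:R) * _ * _]mulrA ler_wpM2l ?ler0q ?padic_abs_ge0//.
  by rewrite [leRHS]mulrCA ler_pM ?ler0q ?padic_abs_ge0//; exact: form_padic_bound.
apply: le_lt_trans (ler_pM _ _ B1 B2) _; rewrite ?ler0q ?padic_abs_ge0//.
rewrite mulrACA -rmorphM -!expRD.
rewrite (_ : expR _ = expR (- (e * n%:R))); first by near: n.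
by congr expR; rewrite /e; field.
Unshelve. all: by end_near. Qed.

End Vanishing.

(** * Linear independence of the values *)

Theorem theorem11p2 (R : realType) (p d : nat) (m : 'I_d -> nat)
    (alpha : 'I_d -> rat) (x : rat) (beta rho_oo rho_p delta : R)
    (D : nat -> nat)
    (hp : prime p) (hd : (0 < d)%N) (hm : forall i, (0 < m i)%N)
    (halpha1 : alpha (Ordinal hd) = 0)
    (halpha : forall i j : 'I_d, i != j -> alpha i - alpha j \isn't a Num.int)
    (hx : (q_ p)%:R * \big[Num.max/1]_i padic_abs p (alpha i)
          <= padic_abs p x)
    (hD : forall n, (0 < D n)%N)
    (hDP : forall (n : nat) (u : index_set m) (l : nat), (l <= Mtot m)%N ->
       (D n)%:R * (Ppoly m alpha n l).[x] \is a Num.int /\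
       (D n)%:R * (Qpoly m alpha n (idx_i u) (idx_s u) l).[x] \is a Num.int)
    (hbeta : forall (u : index_set m) (l : nat), (l <= Mtot m)%N ->
       (limsup_root R (fun n =>
          Num.max `|(Ppoly m alpha n l).[x]|
                  `|(Qpoly m alpha n (idx_i u) (idx_s u) l).[x]|)%R
        <= (expR beta)%:E)%E)
    (hrho_oo : (limsup_root R (fun n => (D n)%:R%R) <= (expR rho_oo)%:E)%E)
    (hrho_p : (limsup_root R (fun n => padic_abs p (D n)%:R%R)
               <= (expR (- rho_p))%:E)%E)
    (hdelta : forall (u : index_set m) (l : nat), (l <= Mtot m)%N ->
       (limsup_root R (fun n =>
          Qp_abs (Rfrak m alpha p n (idx_i u) (idx_s u) l x))
        <= (expR (- delta))%:E)%E)
    (hlt : beta + rho_oo < delta + rho_p) :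
  Qp_lin_indep (fun o : option (index_set m) =>
    if o is Some u then Rvalue p (alpha (idx_i u)) (idx_s u) x else 1).
Proof.
(* The pair [(1,2)] is an index because [m_1 >= 1]; it gives access to the hypotheses on [Ppoly],
   which are stated together with those on [Qpoly]. *)
have [u0 _] : exists u : index_set m, idx_i u = Ordinal hd /\ idx_s u = 2%N.
  by apply: index_set_ex => //; rewrite ltnS hm.
have lM (l : 'I_(Mtot m).+1) : (l <= Mtot m)%N by rewrite -ltnS.
move=> c hc.
have [n form0] : exists n, forall l : 'I_(Mtot m).+1,
    c None * (Ppoly m alpha n l).[x] +
    \sum_u c (Some u) * (Qpoly m alpha n (idx_i u) (idx_s u) l).[x] = 0.
  apply: (@form_eventually_zero R p _ 'I_(Mtot m).+1 u0 c D
    (fun n l => (Ppoly m alpha n l).[x])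
    (fun n u l => (Qpoly m alpha n (idx_i u) (idx_s u) l).[x])
    (fun n u l => Rfrak m alpha p n (idx_i u) (idx_s u) l x)
    beta rho_oo rho_p delta hp
    (fun n l => (hDP n u0 l (lM l)).1) (fun n u l => (hDP n u l (lM l)).2)
    hD (fun u l => hbeta u l (lM l)) hrho_oo hrho_p
    (fun u l => hdelta u l (lM l)) hlt) => n l.
  (* Multiplied by [P_{n,l}(x)], the relation turns each [P R_u] into [Rfrak_u + Q_u], which equates
     the form with minus the sum of remainders. *)
  have := congr1 ( *%R (Qp_of_rat p (Ppoly m alpha n l).[x])) hc.
  rewrite mulr0 big_option mulr1 mulrDr mulr_sumr => h.
  apply/eqP; rewrite -addr_eq0 rmorphD rmorphM rmorph_sum /=.
  rewrite -[eqbRHS]h -addrA -big_split mulrC; apply/eqP; congr (_ + _).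
  by apply: eq_bigr => u _; rewrite rmorphM /Rfrak /=; ring.
apply: (@PQ_rows_independent _ _ _ hd halpha1 halpha n x).
by move=> l lm; have := form0 (Ordinal (lm : (l < (Mtot m).+1)%N)).
Qed.
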